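(* Let $\mathcal O$ be a dg operad. (1) The inclusion of dg operads $\mathcal O\hookrightarrow\mathcal O[m]$ is a quasi-isomorphism. (2) The dg operad $\hat{\mathcal O}$ is acyclic.
   Context: $\mathbf k$ is a field of characteristic $0$; vector spaces are $\mathbb Z/2$-graded and dg means differential $\mathbb Z/2$-graded. Operads are non-unital: collections $\mathcal O(n)$, $n\ge0$, with $S_n$-actions and partial compositions $\circ_i$. An operad is acyclic if $\mathcal O(n)$ has zero homology for all $n$. Inner twisting: for a dg operad $\mathcal P$ and $a\in\mathcal P(1)$, let $\delta_a$ be the derivation $\delta_a(z)=a\circ_1z-(-1)^{|a||z|}\sum_{i=1}^nz\circ_ia$ for $z\in\mathcal P(n)$. An MC element in $\mathcal P(1)$ is an odd $m\in\mathcal P(1)$ with $d(m)+m\circ_1m=0$; then $\mathcal P^m$ is the dg operad with the same underlying operad as $\mathcal P$ and differential $d+\delta_m$. Hat construction: $\mathcal O[m]$ is the operad generated freely by $\mathcal O$ and an odd element $m$ of arity $1$; its differential is determined by requiring that $\mathcal O$ be a dg suboperad and $d(m)=-m^2$ (where $m^2=m\circ_1m$), so that $m$ is an MC element. $\hat{\mathcal O}:=(\mathcal O[m])^m$. *)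

(* Defs.v *)
From HB Require Import structures.
From mathcomp Require Import all_boot all_order all_algebra all_fingroup.
From mathcomp Require Import zify boolp.

Set Implicit Arguments.
Unset Strict Implicit.
Unset Printing Implicit Defensive.

Import GRing.Theory.
Local Open Scope ring_scope.
Local Open Scope quotient_scope.

(* A Z/2-graded vector space is given by its even (index [false]) and odd     *)
(* (index [true]) components, so that an element of [P n p] is a homogeneous  *)
(* element of arity [n] and parity [p]; maps of degree 0 preserve [p], odd    *)
(* maps send [p] to [~~ p]. Inputs are numbered from 0. Arities and parities  *)
(* of composites are tied by explicit equations ([c.+1 = a + b] and           *)
(* [r = p (+) q]) instead of being computed, which avoids all transports.     *)

(* The input [j != i] of an [a]-ary [x], seen as an input of [x o_i y], where *)
(* [y] has arity [b].                                                         *)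
Definition outer (b i j : nat) : nat := if (j < i)%N then j else (j + b).-1.

(* [u] is the permutation [s o_i t] of the inputs of a partial composition.   *)
Definition block_perm (a b c : nat) (i : 'I_a) (s : 'S_a) (t : 'S_b)
    (u : 'S_c) : Prop :=
  (forall (l : 'I_b) (v : 'I_c), v = (i + l)%N :> nat ->
     u v = (s i + t l)%N :> nat) /\
  (forall (j : 'I_a) (v : 'I_c), j != i -> v = outer b i j :> nat ->
     u v = outer b (s i) (s j) :> nat).

(* Non-unital operads in Z/2-graded vector spaces over [k]. The action is a   *)
(* right action for the usual composition of permutations: the product        *)
(* [(t * s)%g] of MathComp is "first [t], then [s]", and the input [j] of     *)
(* [act s x] is the input [s j] of [x].                                       *)
Record operad (k : fieldType) := Operad {
  obj :> nat -> bool -> lmodType k;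
  act : forall n p, 'S_n -> obj n p -> obj n p;
  comp : forall a b c p q r, c.+1 = (a + b)%N -> r = p (+) q ->
    'I_a -> obj a p -> obj b q -> obj c r;
  act_lin : forall n p (s : 'S_n), linear (@act n p s);
  act1 : forall n p (x : obj n p), act 1%g x = x;
  actM : forall n p (s t : 'S_n) (x : obj n p),
    act t (act s x) = act (t * s)%g x;
  comp_linl : forall a b c p q r (ec : c.+1 = (a + b)%N) (er : r = p (+) q)
    (i : 'I_a) (y : obj b q), linear (fun x : obj a p => comp ec er i x y);
  comp_linr : forall a b c p q r (ec : c.+1 = (a + b)%N) (er : r = p (+) q)
    (i : 'I_a) (x : obj a p), linear (fun y : obj b q => comp ec er i x y);
  comp_act : forall a b c p q r (ec : c.+1 = (a + b)%N) (er : r = p (+) q)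
    (i : 'I_a) (s : 'S_a) (t : 'S_b) (u : 'S_c) (x : obj a p) (y : obj b q),
    block_perm i s t u ->
    comp ec er i (act s x) (act t y) = act u (comp ec er (s i) x y);
  (* (x o_i y) o_(i+j) z = x o_i (y o_j z) *)
  comp_seq : forall a b c ab bc abc p q r pq qr pqr
    (e1 : ab.+1 = (a + b)%N) (f1 : pq = p (+) q)
    (e2 : abc.+1 = (ab + c)%N) (f2 : pqr = pq (+) r)
    (e3 : bc.+1 = (b + c)%N) (f3 : qr = q (+) r)
    (e4 : abc.+1 = (a + bc)%N) (f4 : pqr = p (+) qr)
    (i : 'I_a) (j : 'I_b) (l : 'I_ab) (x : obj a p) (y : obj b q) (z : obj c r),
    l = (i + j)%N :> nat ->
    comp e2 f2 l (comp e1 f1 i x y) z = comp e4 f4 i x (comp e3 f3 j y z);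
  (* (x o_i y) o_(j+b-1) z = (-1)^(|y||z|) (x o_j z) o_i y   for i < j *)
  comp_par : forall a b c ab ac abc p q r pq pr pqr
    (e1 : ab.+1 = (a + b)%N) (f1 : pq = p (+) q)
    (e2 : abc.+1 = (ab + c)%N) (f2 : pqr = pq (+) r)
    (e3 : ac.+1 = (a + c)%N) (f3 : pr = p (+) r)
    (e4 : abc.+1 = (ac + b)%N) (f4 : pqr = pr (+) q)
    (i j : 'I_a) (l : 'I_ab) (i' : 'I_ac)
    (x : obj a p) (y : obj b q) (z : obj c r),
    (i < j)%N -> l = (j + b).-1 :> nat -> i' = i :> nat ->
    comp e2 f2 l (comp e1 f1 i x y) z =
    (-1) ^+ (q && r) *: comp e4 f4 i' (comp e3 f3 j x z) y
}.

Record dgOperad (k : fieldType) := DGOperad {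
  dg_under :> operad k;
  dd : forall n p, dg_under n p -> dg_under n (~~ p);
  dd_lin : forall n p, linear (@dd n p);
  dd_dd : forall n p (x : dg_under n p), dd (dd x) = 0;
  dd_act : forall n p (s : 'S_n) (x : dg_under n p), dd (act s x) = act s (dd x);
  dd_comp : forall a b c p q r (ec : c.+1 = (a + b)%N) (er : r = p (+) q)
    (er1 : ~~ r = ~~ p (+) q) (er2 : ~~ r = p (+) ~~ q)
    (i : 'I_a) (x : dg_under a p) (y : dg_under b q),
    dd (comp ec er i x y) =
    comp ec er1 i (dd x) y + (-1) ^+ p *: comp ec er2 i x (dd y)
}.

Record operad_mor (k : fieldType) (P Q : operad k) := OperadMor {
  fmor :> forall n p, P n p -> Q n p;
  fmor_lin : forall n p, linear (@fmor n p);
  fmor_act : forall n p (s : 'S_n) (x : P n p), fmor (act s x) = act s (fmor x);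
  fmor_comp : forall a b c p q r (ec : c.+1 = (a + b)%N) (er : r = p (+) q)
    (i : 'I_a) (x : P a p) (y : P b q),
    fmor (comp ec er i x y) = comp ec er i (fmor x) (fmor y)
}.

Record dg_mor (k : fieldType) (P Q : dgOperad k) := DGMor {
  dgmor :> operad_mor P Q;
  dgmor_dd : forall n p (x : P n p), dgmor _ _ (dd x) = dd (dgmor _ _ x)
}.

Section Homology.
Variables (k : fieldType) (P : dgOperad k).

Definition is_cycle n p (x : P n p) : Prop := dd x = 0.

(* Boundaries of parity [p] are the images of elements of parity [~~ p]; as   *)
(* [dd] lands in parity [~~ q], the equation [p = ~~ q] is eliminated by      *)
(* stating this as an inductive predicate.                                    *)
Inductive is_boundary n : forall p, P n p -> Prop :=
  Boundary q (y : P n q) : is_boundary (dd y).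

Definition acyclic : Prop := forall n p (x : P n p), is_cycle x -> is_boundary x.
End Homology.

(* The map induced by [f] on the homology ker d / im d is bijective in each   *)
(* arity and parity.                                                          *)
Definition quasi_iso (k : fieldType) (P Q : dgOperad k) (f : dg_mor P Q) :=
  (forall n p (x : P n p), is_cycle x -> is_boundary (f n p x) -> is_boundary x) /\
  (forall n p (y : Q n p), is_cycle y ->
     exists x : P n p, is_cycle x /\ is_boundary (y - f n p x)).

Section Lin.
Variables (k : fieldType) (P : operad k).

Lemma lin0 (U V : lmodType k) (f : U -> V) : linear f -> f 0 = 0.
Proof. by move=> h; have := h (-1) 0 0; rewrite scaler0 addr0 scaleN1r addNr. Qed.
Lemma linD (U V : lmodType k) (f : U -> V) : linear f -> {morph f : x y / x + y}.
Proof. by move=> h x y; have := h 1 x y; rewrite !scale1r. Qed.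
Lemma linZ (U V : lmodType k) (f : U -> V) :
  linear f -> forall c, {morph f : x / c *: x}.
Proof. by move=> h c x; have := h c x 0; rewrite (lin0 h) !addr0. Qed.
Lemma linN (U V : lmodType k) (f : U -> V) : linear f -> {morph f : x / - x}.
Proof. by move=> h x; rewrite -!scaleN1r (linZ h). Qed.
Lemma linS (U V : lmodType k) (f : U -> V) : linear f ->
  forall n (F : 'I_n -> U), f (\sum_i F i) = \sum_i f (F i).
Proof.
move=> h n F; apply: (big_morph f (linD h) (lin0 h)).
Qed.

Lemma comp_irr a b c p q r (ec ec' : c.+1 = (a + b)%N) (er er' : r = p (+) q)
    (i i' : 'I_a) (x : P a p) (y : P b q) : i = i' :> nat ->
  comp ec er i x y = comp ec' er' i' x y.
Proof.
move=> /ord_inj ->.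
by rewrite (eq_irrelevance ec ec') (eq_irrelevance er er').
Qed.
End Lin.

Definition parNl (p q r : bool) : r = p (+) q -> ~~ r = ~~ p (+) q.
Proof. by move->; rewrite addNb. Qed.
Definition parNr (p q r : bool) : r = p (+) q -> ~~ r = p (+) ~~ q.
Proof. by move->; rewrite addbN. Qed.
Definition parC (p q r : bool) : r = p (+) q -> r = q (+) p.
Proof. by move->; rewrite addbC. Qed.
Definition ar1 (n : nat) : n.+1 = (n + 1)%N := esym (addn1 n).

(* The operad freely generated by an operad O and an odd unary element m: the *)
(* formal expressions in O and m, modulo the congruence generated by the      *)
(* axioms of operads and the operad structure of O.                           *)
Section FreeExtension.
Variables (k : fieldType) (O : operad k).

Inductive term : nat -> bool -> Type :=
| Tgen n p of O n p : term n p
| Tm : term 1 true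
| Tzero n p : term n p
| Tadd n p of term n p & term n p : term n p
| Tscale n p of k & term n p : term n p
| Tact n p of 'S_n & term n p : term n p
| Tcomp a b c p q r of c.+1 = (a + b)%N & r = p (+) q & 'I_a
    & term a p & term b q : term c r.

Inductive eqt : forall n p, term n p -> term n p -> Prop :=
| Erefl n p (x : term n p) : eqt x x
| Esym n p (x y : term n p) : eqt x y -> eqt y x
| Etrans n p (x y z : term n p) : eqt x y -> eqt y z -> eqt x z
| Cadd n p (x x' y y' : term n p) :
    eqt x x' -> eqt y y' -> eqt (Tadd x y) (Tadd x' y')
| Cscale n p c (x x' : term n p) : eqt x x' -> eqt (Tscale c x) (Tscale c x')
| Cact n p s (x x' : term n p) : eqt x x' -> eqt (Tact s x) (Tact s x')
| Ccomp a b c p q r (ec : c.+1 = (a + b)%N) (er : r = p (+) q) i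
    (x x' : term a p) (y y' : term b q) : eqt x x' -> eqt y y' ->
    eqt (Tcomp ec er i x y) (Tcomp ec er i x' y')
| EaddA n p (x y z : term n p) : eqt (Tadd x (Tadd y z)) (Tadd (Tadd x y) z)
| EaddC n p (x y : term n p) : eqt (Tadd x y) (Tadd y x)
| Eadd0 n p (x : term n p) : eqt (Tadd (Tzero n p) x) x
| EaddN n p (x : term n p) : eqt (Tadd (Tscale (-1) x) x) (Tzero n p)
| EscaleA n p c e (x : term n p) :
    eqt (Tscale c (Tscale e x)) (Tscale (c * e) x)
| Escale1 n p (x : term n p) : eqt (Tscale 1 x) x
| EscaleDr n p c (x y : term n p) :
    eqt (Tscale c (Tadd x y)) (Tadd (Tscale c x) (Tscale c y))
| EscaleDl n p c e (x : term n p) :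
    eqt (Tscale (c + e) x) (Tadd (Tscale c x) (Tscale e x))
| Eact_lin n p s c (x y : term n p) :
    eqt (Tact s (Tadd (Tscale c x) y)) (Tadd (Tscale c (Tact s x)) (Tact s y))
| Eact1 n p (x : term n p) : eqt (Tact 1%g x) x
| EactM n p s t (x : term n p) : eqt (Tact t (Tact s x)) (Tact (t * s)%g x)
| Ecomp_linl a b c p q r (ec : c.+1 = (a + b)%N) (er : r = p (+) q) i e
    (x x' : term a p) (y : term b q) :
    eqt (Tcomp ec er i (Tadd (Tscale e x) x') y)
        (Tadd (Tscale e (Tcomp ec er i x y)) (Tcomp ec er i x' y))
| Ecomp_linr a b c p q r (ec : c.+1 = (a + b)%N) (er : r = p (+) q) i e
    (x : term a p) (y y' : term b q) :
    eqt (Tcomp ec er i x (Tadd (Tscale e y) y'))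
        (Tadd (Tscale e (Tcomp ec er i x y)) (Tcomp ec er i x y'))
| Ecomp_act a b c p q r (ec : c.+1 = (a + b)%N) (er : r = p (+) q)
    (i : 'I_a) (s : 'S_a) (t : 'S_b) (u : 'S_c) (x : term a p) (y : term b q) :
    block_perm i s t u ->
    eqt (Tcomp ec er i (Tact s x) (Tact t y)) (Tact u (Tcomp ec er (s i) x y))
| Ecomp_seq a b c ab bc abc p q r pq qr pqr
    (e1 : ab.+1 = (a + b)%N) (f1 : pq = p (+) q)
    (e2 : abc.+1 = (ab + c)%N) (f2 : pqr = pq (+) r)
    (e3 : bc.+1 = (b + c)%N) (f3 : qr = q (+) r)
    (e4 : abc.+1 = (a + bc)%N) (f4 : pqr = p (+) qr)
    (i : 'I_a) (j : 'I_b) (l : 'I_ab)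
    (x : term a p) (y : term b q) (z : term c r) :
    l = (i + j)%N :> nat ->
    eqt (Tcomp e2 f2 l (Tcomp e1 f1 i x y) z)
        (Tcomp e4 f4 i x (Tcomp e3 f3 j y z))
| Ecomp_par a b c ab ac abc p q r pq pr pqr
    (e1 : ab.+1 = (a + b)%N) (f1 : pq = p (+) q)
    (e2 : abc.+1 = (ab + c)%N) (f2 : pqr = pq (+) r)
    (e3 : ac.+1 = (a + c)%N) (f3 : pr = p (+) r)
    (e4 : abc.+1 = (ac + b)%N) (f4 : pqr = pr (+) q)
    (i j : 'I_a) (l : 'I_ab) (i' : 'I_ac)
    (x : term a p) (y : term b q) (z : term c r) :
    (i < j)%N -> l = (j + b).-1 :> nat -> i' = i :> nat ->
    eqt (Tcomp e2 f2 l (Tcomp e1 f1 i x y) z)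
        (Tscale ((-1) ^+ (q && r)) (Tcomp e4 f4 i' (Tcomp e3 f3 j x z) y))
| Egen_lin n p c (x y : O n p) :
    eqt (Tgen (c *: x + y)) (Tadd (Tscale c (Tgen x)) (Tgen y))
| Egen_act n p s (x : O n p) : eqt (Tgen (act s x)) (Tact s (Tgen x))
| Egen_comp a b c p q r (ec : c.+1 = (a + b)%N) (er : r = p (+) q) i
    (x : O a p) (y : O b q) :
    eqt (Tgen (comp ec er i x y)) (Tcomp ec er i (Tgen x) (Tgen y)).

HB.instance Definition _ n p := gen_eqMixin (term n p).
HB.instance Definition _ n p := gen_choiceMixin (term n p).

Section Quotient.
Variables (n : nat) (p : bool).

Definition eqtb (x y : term n p) : bool := `[< eqt x y >].
Lemma eqtb_refl : reflexive eqtb.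
Proof. by move=> x; apply/asboolP; exact: Erefl. Qed.
Lemma eqtb_sym : symmetric eqtb.
Proof. by move=> x y; apply/asboolP/asboolP; exact: Esym. Qed.
Lemma eqtb_trans : transitive eqtb.
Proof.
by move=> y x z /asboolP h /asboolP h'; apply/asboolP; exact: Etrans h h'.
Qed.
Canonical eqt_equiv := EquivRel eqtb eqtb_refl eqtb_sym eqtb_trans.

Definition free : Type := {eq_quot eqt_equiv}.
HB.instance Definition _ := Choice.on free.
HB.instance Definition _ := EqQuotient.on free.

Definition cls (x : term n p) : free := \pi_free x.
Definition rep (x : free) : term n p := generic_quotient.repr x.

Lemma repK x : cls (rep x) = x. Proof. exact: generic_quotient.reprK. Qed.
Lemma clsP x y : cls x = cls y <-> eqt x y.
Proof.
split; first by move/eqP; rewrite piE => /asboolP.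
by move=> h; apply/eqP; rewrite piE; apply/asboolP.
Qed.
Lemma eqt_rep x : eqt (rep (cls x)) x.
Proof. by apply/clsP; rewrite repK. Qed.

Definition fzero := cls (Tzero n p).
Definition fadd x y := cls (Tadd (rep x) (rep y)).
Definition fscale c x := cls (Tscale c (rep x)).
Definition fact s x := cls (Tact s (rep x)).

Lemma cls_add x y : cls (Tadd x y) = fadd (cls x) (cls y).
Proof. by apply/clsP/Cadd; apply/Esym/eqt_rep. Qed.
Lemma cls_scale c x : cls (Tscale c x) = fscale c (cls x).
Proof. by apply/clsP/Cscale; apply/Esym/eqt_rep. Qed.
Lemma cls_act s x : cls (Tact s x) = fact s (cls x).
Proof. by apply/clsP/Cact; apply/Esym/eqt_rep. Qed.

Lemma faddA : associative fadd.
Proof.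
move=> x y z; rewrite -[x]repK -[y]repK -[z]repK -!cls_add.
by apply/clsP; exact: EaddA.
Qed.
Lemma faddC : commutative fadd.
Proof.
by move=> x y; rewrite -[x]repK -[y]repK -!cls_add; apply/clsP; exact: EaddC.
Qed.
Lemma fadd0 : left_id fzero fadd.
Proof. by move=> x; rewrite -[x]repK -cls_add; apply/clsP; exact: Eadd0. Qed.
Lemma faddN : left_inverse fzero (fscale (-1)) fadd.
Proof.
by move=> x; rewrite -[x]repK -cls_scale -cls_add; apply/clsP; exact: EaddN.
Qed.
HB.instance Definition _ := GRing.isZmodule.Build free faddA faddC fadd0 faddN.

Lemma fscaleA c e x : fscale c (fscale e x) = fscale (c * e) x.
Proof. by rewrite -[x]repK -!cls_scale; apply/clsP; exact: EscaleA. Qed.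
Lemma fscale1 : left_id 1 fscale.
Proof. by move=> x; rewrite -[x]repK -!cls_scale; apply/clsP; exact: Escale1. Qed.
Lemma fscaleDr : right_distributive fscale fadd.
Proof.
move=> c x y; have /clsP := EscaleDr c (rep x) (rep y).
by rewrite cls_scale !cls_add !cls_scale !repK.
Qed.
Lemma fscaleDl x c e : fscale (c + e) x = fadd (fscale c x) (fscale e x).
Proof.
have /clsP := EscaleDl c e (rep x).
by rewrite cls_add !cls_scale !repK.
Qed.
HB.instance Definition _ := GRing.Zmodule_isLmodule.Build k free
  fscaleA fscale1 fscaleDr fscaleDl.

Lemma clsD x y : cls (Tadd x y) = cls x + cls y. Proof. exact: cls_add. Qed.
Lemma clsZ c x : cls (Tscale c x) = c *: cls x. Proof. exact: cls_scale. Qed.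
Lemma cls0 : cls (Tzero n p) = 0. Proof. by []. Qed.
End Quotient.

Definition fcomp a b c p q r (ec : c.+1 = (a + b)%N) (er : r = p (+) q)
    (i : 'I_a) (x : free a p) (y : free b q) : free c r :=
  cls (Tcomp ec er i (rep x) (rep y)).

Lemma cls_comp a b c p q r (ec : c.+1 = (a + b)%N) (er : r = p (+) q)
    (i : 'I_a) (x : term a p) (y : term b q) :
  cls (Tcomp ec er i x y) = fcomp ec er i (cls x) (cls y).
Proof. by apply/clsP/Ccomp; apply/Esym/eqt_rep. Qed.

Definition clsE := (clsD, clsZ, cls_act, cls_comp).

Fact fact_lin n p (s : 'S_n) : linear (@fact n p s).
Proof.
move=> c x y; have /clsP := Eact_lin s c (rep x) (rep y).
by rewrite !clsE !repK.
Qed.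
Fact fact1 n p (x : free n p) : fact 1%g x = x.
Proof. by have /clsP := Eact1 (rep x); rewrite !clsE !repK. Qed.
Fact factM n p (s t : 'S_n) (x : free n p) :
  fact t (fact s x) = fact (t * s)%g x.
Proof. by have /clsP := EactM s t (rep x); rewrite !clsE !repK. Qed.
Fact fcomp_linl a b c p q r (ec : c.+1 = (a + b)%N) (er : r = p (+) q)
  (i : 'I_a) (y : free b q) : linear (fun x : free a p => fcomp ec er i x y).
Proof.
move=> e x x'; have /clsP := Ecomp_linl ec er i e (rep x) (rep x') (rep y).
by rewrite !clsE !repK.
Qed.
Fact fcomp_linr a b c p q r (ec : c.+1 = (a + b)%N) (er : r = p (+) q)
  (i : 'I_a) (x : free a p) : linear (fun y : free b q => fcomp ec er i x y).
Proof.
move=> e y y'; have /clsP := Ecomp_linr ec er i e (rep x) (rep y) (rep y').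
by rewrite !clsE !repK.
Qed.

Fact fcomp_act a b c p q r (ec : c.+1 = (a + b)%N) (er : r = p (+) q)
    (i : 'I_a) (s : 'S_a) (t : 'S_b) (u : 'S_c) (x : free a p) (y : free b q) :
  block_perm i s t u ->
  fcomp ec er i (fact s x) (fact t y) = fact u (fcomp ec er (s i) x y).
Proof.
move=> h; have /clsP := Ecomp_act ec er (rep x) (rep y) h.
by rewrite !clsE !repK.
Qed.
Fact fcomp_seq a b c ab bc abc p q r pq qr pqr
    (e1 : ab.+1 = (a + b)%N) (f1 : pq = p (+) q)
    (e2 : abc.+1 = (ab + c)%N) (f2 : pqr = pq (+) r)
    (e3 : bc.+1 = (b + c)%N) (f3 : qr = q (+) r)
    (e4 : abc.+1 = (a + bc)%N) (f4 : pqr = p (+) qr)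
    (i : 'I_a) (j : 'I_b) (l : 'I_ab)
    (x : free a p) (y : free b q) (z : free c r) :
  l = (i + j)%N :> nat ->
  fcomp e2 f2 l (fcomp e1 f1 i x y) z = fcomp e4 f4 i x (fcomp e3 f3 j y z).
Proof.
move=> h.
have /clsP := Ecomp_seq e1 f1 e2 f2 e3 f3 e4 f4 (rep x) (rep y) (rep z) h.
by rewrite !clsE !repK.
Qed.
Fact fcomp_par a b c ab ac abc p q r pq pr pqr
    (e1 : ab.+1 = (a + b)%N) (f1 : pq = p (+) q)
    (e2 : abc.+1 = (ab + c)%N) (f2 : pqr = pq (+) r)
    (e3 : ac.+1 = (a + c)%N) (f3 : pr = p (+) r)
    (e4 : abc.+1 = (ac + b)%N) (f4 : pqr = pr (+) q)
    (i j : 'I_a) (l : 'I_ab) (i' : 'I_ac)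
    (x : free a p) (y : free b q) (z : free c r) :
  (i < j)%N -> l = (j + b).-1 :> nat -> i' = i :> nat ->
  fcomp e2 f2 l (fcomp e1 f1 i x y) z =
  (-1) ^+ (q && r) *: fcomp e4 f4 i' (fcomp e3 f3 j x z) y.
Proof.
move=> h h' h''.
have /clsP := Ecomp_par e1 f1 e2 f2 e3 f3 e4 f4 (rep x) (rep y) (rep z) h h' h''.
by rewrite !clsE !repK.
Qed.

Definition free_operad : operad k :=
  @Operad k (fun n p => free n p) fact fcomp fact_lin fact1 factM
    fcomp_linl fcomp_linr fcomp_act fcomp_seq fcomp_par.

Definition finc n p (x : O n p) : free_operad n p := cls (Tgen x).

Fact finc_lin n p : linear (@finc n p).
Proof. by move=> c x y; have /clsP := Egen_lin c x y; rewrite !clsE. Qed.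
Fact finc_act n p (s : 'S_n) (x : O n p) : finc (act s x) = act s (finc x).
Proof. by have /clsP := Egen_act s x; rewrite !clsE. Qed.
Fact finc_comp a b c p q r (ec : c.+1 = (a + b)%N) (er : r = p (+) q)
    (i : 'I_a) (x : O a p) (y : O b q) :
  finc (comp ec er i x y) = comp ec er i (finc x) (finc y).
Proof. by have /clsP := Egen_comp ec er i x y; rewrite !clsE. Qed.

Definition free_incl : operad_mor O free_operad :=
  OperadMor finc_lin finc_act finc_comp.

Definition free_m : free_operad 1 true := cls Tm.

End FreeExtension.

Lemma Tind (k : fieldType) (O : operad k)
    (T : forall n p, free_operad O n p -> Prop) :
  (forall n p x, T n p (free_incl O n p x)) -> T _ _ (free_m O) ->
  (forall n p, T n p 0) ->
  (forall n p x y, T n p x -> T n p y -> T n p (x + y)) ->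
  (forall n p c x, T n p x -> T n p (c *: x)) ->
  (forall n p s x, T n p x -> T n p (act s x)) ->
  (forall a b c p q r (ec : c.+1 = (a + b)%N) (er : r = p (+) q) i x y,
     T a p x -> T b q y -> T c r (comp ec er i x y)) ->
  forall n p x, T n p x.
Proof.
move=> hg hm h0 hD hZ hA hC n p x; rewrite -[x]repK.
elim: (rep x) => {n p x} [||n p|n p x hx y hy|n p c x hx|n p s x hx|
  a b c p q r ec er i x hx y hy].
- exact: hg.
- exact: hm.
- exact: h0.
- by rewrite clsD; exact: hD.
- by rewrite clsZ; exact: hZ.
- by rewrite cls_act; exact: hA.
- by rewrite cls_comp; exact: hC.
Qed.

(* The universal property of the free extension, which characterizes it.      *)
Section Universal.
Variables (k : fieldType) (O P : operad k) (f : operad_mor O P) (m : P 1 true).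

Fixpoint teval n p (t : term O n p) : P n p :=
  match t in term _ n p return P n p with
  | Tgen _ _ x => f _ _ x
  | Tm => m
  | Tzero _ _ => 0
  | Tadd _ _ x y => teval x + teval y
  | Tscale _ _ c x => c *: teval x
  | Tact _ _ s x => act s (teval x)
  | Tcomp _ _ _ _ _ _ ec er i x y => comp ec er i (teval x) (teval y)
  end.

Lemma teval_eqt n p (x y : term O n p) : eqt x y -> teval x = teval y.
Proof.
elim=> {n p x y} //=; intros; try congruence.
- by rewrite addrA.
- by rewrite addrC.
- by rewrite add0r.
- by rewrite scaleN1r addNr.
- by rewrite scalerA.
- by rewrite scale1r.
- by rewrite scalerDr.
- by rewrite scalerDl.
- exact: act_lin.
- exact: act1.
- exact: actM.
- exact: (comp_linl ec er i).
- exact: (comp_linr ec er i).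
- exact: comp_act.
- exact: comp_seq.
- exact: comp_par.
- exact: fmor_lin.
- exact: fmor_act.
- exact: fmor_comp.
Qed.

Definition flift n p (x : free_operad O n p) : P n p := teval (rep x).

Lemma flift_cls n p (x : term O n p) : flift (cls x) = teval x.
Proof. exact/teval_eqt/eqt_rep. Qed.

Fact flift_lin n p : linear (@flift n p).
Proof.
move=> c x y; have := flift_cls (Tadd (Tscale c (rep x)) (rep y)).
by rewrite !clsE !repK.
Qed.
Fact flift_act n p (s : 'S_n) (x : free_operad O n p) :
  flift (act s x) = act s (flift x).
Proof. by have := flift_cls (Tact s (rep x)); rewrite !clsE !repK. Qed.
Fact flift_comp a b c p q r (ec : c.+1 = (a + b)%N) (er : r = p (+) q)
    (i : 'I_a) (x : free_operad O a p) (y : free_operad O b q) :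
  flift (comp ec er i x y) = comp ec er i (flift x) (flift y).
Proof.
by have := flift_cls (Tcomp ec er i (rep x) (rep y)); rewrite !clsE !repK.
Qed.

Definition free_lift : operad_mor (free_operad O) P :=
  OperadMor flift_lin flift_act flift_comp.

Lemma free_lift_incl n p (x : O n p) : free_lift n p (free_incl O n p x) = f n p x.
Proof. exact: (flift_cls (Tgen x)). Qed.

Lemma free_lift_m : free_lift 1 true (free_m O) = m.
Proof. exact: (flift_cls (Tm O)). Qed.

Lemma free_lift_uniq (g : operad_mor (free_operad O) P) :
  (forall n p (x : O n p), g n p (free_incl O n p x) = f n p x) ->
  g 1 true (free_m O) = m ->
  forall n p (x : free_operad O n p), g n p x = free_lift n p x.
Proof.
move=> hf hm; apply: Tind.
- by move=> n p x; rewrite hf free_lift_incl.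
- by rewrite hm free_lift_m.
- by move=> n p; rewrite !(lin0 (@fmor_lin _ _ _ _ _ _)).
- by move=> n p x y hx hy; rewrite !(linD (@fmor_lin _ _ _ _ _ _)) hx hy.
- by move=> n p c x hx; rewrite !(linZ (@fmor_lin _ _ _ _ _ _)) hx.
- by move=> n p s x hx; rewrite !fmor_act hx.
- by move=> a b c p q r ec er i x y hx hy; rewrite !fmor_comp hx hy.
Qed.
End Universal.

Definition id_mor (k : fieldType) (O : operad k) : operad_mor O O.
Proof. by refine (@OperadMor k O O (fun n p x => x) _ _ _). Defined.

Lemma free_incl_inj (k : fieldType) (O : operad k) n p :
  injective (free_incl O n p).
Proof.
move=> x y e; rewrite -[x](free_lift_incl (id_mor O) 0).
by rewrite e (free_lift_incl (id_mor O) 0).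
Qed.

Section CompLin.
Variables (k : fieldType) (P : operad k) (a b c : nat) (p q r : bool).
Variables (ec : c.+1 = (a + b)%N) (er : r = p (+) q) (i : 'I_a).
Lemma compDl (x x' : P a p) (y : P b q) :
  comp ec er i (x + x') y = comp ec er i x y + comp ec er i x' y.
Proof. exact: (linD (comp_linl ec er i y)). Qed.
Lemma compDr (x : P a p) (y y' : P b q) :
  comp ec er i x (y + y') = comp ec er i x y + comp ec er i x y'.
Proof. exact: (linD (comp_linr ec er i x)). Qed.
Lemma compZl e (x : P a p) (y : P b q) :
  comp ec er i (e *: x) y = e *: comp ec er i x y.
Proof. exact: (linZ (comp_linl ec er i y)). Qed.
Lemma compZr e (x : P a p) (y : P b q) :
  comp ec er i x (e *: y) = e *: comp ec er i x y.
Proof. exact: (linZ (comp_linr ec er i x)). Qed.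
Lemma compNl (x : P a p) (y : P b q) :
  comp ec er i (- x) y = - comp ec er i x y.
Proof. exact: (linN (comp_linl ec er i y)). Qed.
Lemma compNr (x : P a p) (y : P b q) :
  comp ec er i x (- y) = - comp ec er i x y.
Proof. exact: (linN (comp_linr ec er i x)). Qed.
Lemma comp0l (y : P b q) : comp ec er i (0 : P a p) y = 0.
Proof. exact: (lin0 (comp_linl ec er i y)). Qed.
Lemma comp0r (x : P a p) : comp ec er i x (0 : P b q) = 0.
Proof. exact: (lin0 (comp_linr ec er i x)). Qed.
Lemma compSl n (F : 'I_n -> P a p) (y : P b q) :
  comp ec er i (\sum_j F j) y = \sum_j comp ec er i (F j) y.
Proof. exact: (linS (comp_linl ec er i y)). Qed.
Lemma compSr n (F : 'I_n -> P b q) (x : P a p) :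
  comp ec er i x (\sum_j F j) = \sum_j comp ec er i x (F j).
Proof. exact: (linS (comp_linr ec er i x)). Qed.
End CompLin.

Lemma actD (k : fieldType) (P : operad k) n p (s : 'S_n) (x y : P n p) :
  act s (x + y) = act s x + act s y.
Proof. exact: (linD (@act_lin _ _ _ _ _)). Qed.
Lemma actZ (k : fieldType) (P : operad k) n p (s : 'S_n) c (x : P n p) :
  act s (c *: x) = c *: act s x.
Proof. exact: (linZ (@act_lin _ _ _ _ _)). Qed.

Section Derivations.
Variables (k : fieldType) (P : operad k).

Lemma sgn1 (p q pq r : bool) : pq = p (+) q ->
  (-1) ^+ pq * (-1) ^+ (q && ~~ r) = (-1) ^+ (q && r) * (-1) ^+ p :> k.
Proof. by move->; rewrite -!signr_addb; case: p q r => [] [] []. Qed.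
Lemma sgn2 (p q r pr : bool) : pr = p (+) r ->
  (-1) ^+ p * (-1) ^+ (~~ q && r) = (-1) ^+ (q && r) * (-1) ^+ pr :> k.
Proof. by move->; rewrite -!signr_addb; case: p q r => [] [] []. Qed.

Lemma der_linl a b c p q r (ec : c.+1 = (a + b)%N) (er : r = p (+) q)
    (i : 'I_a) e (x1 x2 : P a p) (x1' x2' : P a (~~ p)) (y : P b q)
    (y' : P b (~~ q)) :
  comp ec (parNl er) i (e *: x1' + x2') y +
  (-1) ^+ p *: comp ec (parNr er) i (e *: x1 + x2) y' =
  e *: (comp ec (parNl er) i x1' y + (-1) ^+ p *: comp ec (parNr er) i x1 y') +
  (comp ec (parNl er) i x2' y + (-1) ^+ p *: comp ec (parNr er) i x2 y').
Proof.
rewrite !compDl !compZl !scalerDr !scalerA [_ * e]mulrC -!scalerA.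
by rewrite addrACA.
Qed.

Lemma der_linr a b c p q r (ec : c.+1 = (a + b)%N) (er : r = p (+) q)
    (i : 'I_a) e (x : P a p) (x' : P a (~~ p)) (y1 y2 : P b q)
    (y1' y2' : P b (~~ q)) :
  comp ec (parNl er) i x' (e *: y1 + y2) +
  (-1) ^+ p *: comp ec (parNr er) i x (e *: y1' + y2') =
  e *: (comp ec (parNl er) i x' y1 + (-1) ^+ p *: comp ec (parNr er) i x y1') +
  (comp ec (parNl er) i x' y2 + (-1) ^+ p *: comp ec (parNr er) i x y2').
Proof.
rewrite !compDr !compZr !scalerDr !scalerA [_ * e]mulrC -!scalerA.
by rewrite addrACA.
Qed.

Lemma der_act a b c p q r (ec : c.+1 = (a + b)%N) (er : r = p (+) q)
    (i : 'I_a) (s : 'S_a) (t : 'S_b) (u : 'S_c) (x : P a p) (x' : P a (~~ p))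
    (y : P b q) (y' : P b (~~ q)) : block_perm i s t u ->
  comp ec (parNl er) i (act s x') (act t y) +
  (-1) ^+ p *: comp ec (parNr er) i (act s x) (act t y') =
  act u (comp ec (parNl er) (s i) x' y +
         (-1) ^+ p *: comp ec (parNr er) (s i) x y').
Proof. by move=> h; rewrite !(comp_act _ _ _ _ h) actD actZ. Qed.

Lemma der_seq a b c ab bc abc p q r pq qr pqr
    (e1 : ab.+1 = (a + b)%N) (f1 : pq = p (+) q)
    (e2 : abc.+1 = (ab + c)%N) (f2 : pqr = pq (+) r)
    (e3 : bc.+1 = (b + c)%N) (f3 : qr = q (+) r)
    (e4 : abc.+1 = (a + bc)%N) (f4 : pqr = p (+) qr)
    (i : 'I_a) (j : 'I_b) (l : 'I_ab) (x : P a p) (y : P b q) (z : P c r)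
    (x' : P a (~~ p)) (y' : P b (~~ q)) (z' : P c (~~ r)) :
  l = (i + j)%N :> nat ->
  comp e2 (parNl f2) l (comp e1 (parNl f1) i x' y +
    (-1) ^+ p *: comp e1 (parNr f1) i x y') z +
  (-1) ^+ pq *: comp e2 (parNr f2) l (comp e1 f1 i x y) z' =
  comp e4 (parNl f4) i x' (comp e3 f3 j y z) +
  (-1) ^+ p *: comp e4 (parNr f4) i x (comp e3 (parNl f3) j y' z +
    (-1) ^+ q *: comp e3 (parNr f3) j y z').
Proof.
move=> h; rewrite compDl compZl compDr compZr.
rewrite (comp_seq _ _ _ _ e3 f3 e4 (parNl f4) _ _ _ h).
rewrite (comp_seq _ _ _ _ e3 (parNl f3) e4 (parNr f4) _ _ _ h).
rewrite (comp_seq _ _ _ _ e3 (parNr f3) e4 (parNr f4) _ _ _ h).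
by rewrite scalerDr scalerA f1 signr_addb addrA.
Qed.

Lemma der_par a b c ab ac abc p q r pq pr pqr
    (e1 : ab.+1 = (a + b)%N) (f1 : pq = p (+) q)
    (e2 : abc.+1 = (ab + c)%N) (f2 : pqr = pq (+) r)
    (e3 : ac.+1 = (a + c)%N) (f3 : pr = p (+) r)
    (e4 : abc.+1 = (ac + b)%N) (f4 : pqr = pr (+) q)
    (i j : 'I_a) (l : 'I_ab) (i' : 'I_ac) (x : P a p) (y : P b q) (z : P c r)
    (x' : P a (~~ p)) (y' : P b (~~ q)) (z' : P c (~~ r)) :
  (i < j)%N -> l = (j + b).-1 :> nat -> i' = i :> nat ->
  comp e2 (parNl f2) l (comp e1 (parNl f1) i x' y +
    (-1) ^+ p *: comp e1 (parNr f1) i x y') z +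
  (-1) ^+ pq *: comp e2 (parNr f2) l (comp e1 f1 i x y) z' =
  (-1) ^+ (q && r) *: (comp e4 (parNl f4) i' (comp e3 (parNl f3) j x' z +
    (-1) ^+ p *: comp e3 (parNr f3) j x z') y +
  (-1) ^+ pr *: comp e4 (parNr f4) i' (comp e3 f3 j x z) y').
Proof.
move=> h h' h''; rewrite compDl compZl compDl compZl.
rewrite (comp_par _ _ _ _ e3 (parNl f3) e4 (parNl f4) _ _ _ h h' h'').
rewrite (comp_par _ _ _ _ e3 f3 e4 (parNr f4) _ _ _ h h' h'').
rewrite (comp_par _ _ _ _ e3 (parNr f3) e4 (parNl f4) _ _ _ h h' h'').
rewrite !scalerDr !scalerA -!addrA; congr (_ + _).
by rewrite addrC (sgn1 _ f1) (sgn2 _ f3).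
Qed.
End Derivations.

Definition square (k : fieldType) (P : operad k) (m : P 1 true) : P 1 false :=
  @comp k P 1 1 1 true true false erefl erefl ord0 m m.

(* The dg operad O[m]: its differential is the derivation of the free         *)
(* extension which restricts to that of O and satisfies d(m) = - m^2.         *)
Section FreeDG.
Variables (k : fieldType) (O : dgOperad k).
Notation A := (free_operad O).

Fixpoint tder n p (t : term O n p) : A n (~~ p) :=
  match t in term _ n p return A n (~~ p) with
  | Tgen _ _ x => free_incl O _ _ (dd x)
  | Tm => - square (free_m O)
  | Tzero _ _ => 0
  | Tadd _ _ x y => tder x + tder y
  | Tscale _ _ c x => c *: tder x
  | Tact _ _ s x => act s (tder x)
  | Tcomp _ _ _ p _ _ ec er i x y =>
      comp ec (parNl er) i (tder x) (cls y : A _ _) +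
      (-1) ^+ p *: comp ec (parNr er) i (cls x : A _ _) (tder y)
  end.

Let clsDA n p (x y : term O n p) : (cls (Tadd x y) : A n p) = (cls x : A n p) + cls y.
Proof. exact: clsD. Qed.
Let clsZA n p c (x : term O n p) : (cls (Tscale c x) : A n p) = c *: (cls x : A n p).
Proof. exact: clsZ. Qed.
Let clsAA n p s (x : term O n p) : (cls (Tact s x) : A n p) = act s (cls x : A n p).
Proof. exact: cls_act. Qed.
Let clsCA a b c p q r (ec : c.+1 = (a + b)%N) (er : r = p (+) q)
    (i : 'I_a) (x : term O a p) (y : term O b q) :
  (cls (Tcomp ec er i x y) : A c r) =
  comp ec er i (cls x : A a p) (cls y : A b q).
Proof. exact: cls_comp. Qed.
Let clsEA := (clsDA, clsZA, clsAA, clsCA).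

Lemma tder_eqt n p (x y : term O n p) : eqt x y -> tder x = tder y.
Proof.
elim=> {n p x y} //=; intros; try congruence.
- move/clsP: H => ->; move/clsP: H1 => ->; congruence.
- by rewrite addrA.
- by rewrite addrC.
- by rewrite add0r.
- by rewrite scaleN1r addNr.
- by rewrite scalerA.
- by rewrite scale1r.
- by rewrite scalerDr.
- by rewrite scalerDl.
- exact: (@act_lin _ A).
- exact: (@act1 _ A).
- exact: (@actM _ A).
- by rewrite !clsEA; exact: (@der_linl _ A).
- by rewrite !clsEA; exact: (@der_linr _ A).
- by rewrite !clsEA; exact: (@der_act _ A).
- by rewrite !clsEA; exact: (@der_seq _ A).
- by rewrite !clsEA; exact: (@der_par _ A).
- by rewrite (dd_lin c x y); exact: (@fmor_lin _ _ _ (free_incl O)).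
- by rewrite dd_act; exact: (@fmor_act _ _ _ (free_incl O)).
- rewrite (dd_comp ec er (parNl er) (parNr er)).
  rewrite (linD (@finc_lin _ O _ _)) (linZ (@finc_lin _ O _ _)).
  by rewrite !finc_comp.
Qed.

Definition fder n p (x : A n p) : A n (~~ p) := tder (rep x).

Lemma fder_cls n p (x : term O n p) : fder (cls x) = tder x.
Proof. exact/tder_eqt/eqt_rep. Qed.

Fact fder_lin n p : linear (@fder n p).
Proof.
move=> c x y; have := fder_cls (Tadd (Tscale c (rep x)) (rep y)).
by rewrite !clsEA /= !repK.
Qed.
Fact fder_act n p (s : 'S_n) (x : A n p) : fder (act s x) = act s (fder x).
Proof. by have := fder_cls (Tact s (rep x)); rewrite !clsEA /= !repK. Qed.
Fact fder_comp a b c p q r (ec : c.+1 = (a + b)%N) (er : r = p (+) q)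
    (er1 : ~~ r = ~~ p (+) q) (er2 : ~~ r = p (+) ~~ q)
    (i : 'I_a) (x : A a p) (y : A b q) :
  fder (comp ec er i x y) =
  comp ec er1 i (fder x) y + (-1) ^+ p *: comp ec er2 i x (fder y).
Proof.
have := fder_cls (Tcomp ec er i (rep x) (rep y)); rewrite !clsEA /= !repK => ->.
by rewrite (eq_irrelevance (parNl er) er1) (eq_irrelevance (parNr er) er2).
Qed.

Lemma fder_incl n p (x : O n p) :
  fder (free_incl O n p x) = free_incl O _ _ (dd x).
Proof. exact: (fder_cls (Tgen x)). Qed.
Lemma fder_m : fder (free_m O) = - square (free_m O).
Proof. exact: (fder_cls (Tm O)). Qed.

Fact fder_fder n p (x : A n p) : fder (fder x) = 0.
Proof.
move: n p x; apply: Tind.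
- by move=> n p x; rewrite !fder_incl dd_dd (lin0 (@fmor_lin _ _ _ _ _ _)).
- rewrite fder_m (linN (@fder_lin _ _)) /square.
  rewrite (@fder_comp 1 1 1 true true false erefl erefl erefl erefl).
  rewrite fder_m compNl compNr expr1 scaleN1r opprK addrC.
  apply/eqP; rewrite oppr_eq0 subr_eq0; apply/eqP/esym; exact: (@comp_seq _ A).
- by move=> n p; rewrite !(lin0 (@fder_lin _ _)).
- by move=> n p x y hx hy; rewrite !(linD (@fder_lin _ _)) hx hy addr0.
- by move=> n p c x hx; rewrite !(linZ (@fder_lin _ _)) hx scaler0.
- by move=> n p s x hx; rewrite !fder_act hx (lin0 (@act_lin _ _ _ _ _)).
- move=> a b c p q r ec er i x y hx hy.
  rewrite (fder_comp _ _ (parNl er) (parNr er)) (linD (@fder_lin _ _)).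
  rewrite (linZ (@fder_lin _ _)).
  rewrite (fder_comp _ _ (parNl (parNl er)) (parNr (parNl er))).
  rewrite (fder_comp _ _ (parNl (parNr er)) (parNr (parNr er))).
  rewrite hx hy comp0l comp0r add0r scaler0 addr0.
  rewrite (eq_irrelevance (parNl (parNr er)) (parNr (parNl er))) -scalerDl.
  by rewrite signrN addNr scale0r.
Qed.

Definition free_dg : dgOperad k :=
  DGOperad fder_lin fder_fder fder_act fder_comp.

Definition free_dg_incl : dg_mor O free_dg :=
  @DGMor k O free_dg (free_incl O) (fun n p x => esym (fder_incl x)).
End FreeDG.

(* The derivation delta_m(z) = m o_1 z - (-1)^(|m||z|) sum_i z o_i m.         *)
Definition delta (k : fieldType) (P : operad k) pm (m : P 1 pm) n p r
    (er : r = pm (+) p) (z : P n p) : P n r :=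
  comp (erefl (1 + n)%N : n.+1 = (1 + n)%N) er ord0 m z -
  (-1) ^+ (pm && p) *: \sum_(i < n) comp (ar1 n) (parC er) i z m.

Definition MC (k : fieldType) (P : dgOperad k) (m : P 1 true) : Prop :=
  dd m + square m = 0.

Section SumLemmas.
Variable V : zmodType.

Lemma outer_lt a b c i j :
  c.+1 = (a + b)%N -> (i < a)%N -> (j < a)%N -> j != i -> (outer b i j < c)%N.
Proof. by rewrite /outer => e hi hj /eqP hij; case: (ltnP j i) => h; lia. Qed.

Lemma sum_block a b c (ec : c.+1 = (a + b)%N) (i : 'I_a) (G : nat -> V) :
  \sum_(l < c) G l = \sum_(t < b) G (i + t)%N +
    \sum_(j < a | j != i) G (outer b i j).
Proof.
have hi := ltn_ord i.
rewrite -(big_mkord xpredT G) -(big_mkord xpredT (fun t => G (i + t)%N)).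
rewrite -(big_mkord (fun j => j != i :> nat) (fun j => G (outer b i j))).
rewrite (@big_cat_nat _ _ _ i 0 c) //=; last by lia.
rewrite (@big_cat_nat _ _ _ (i + b) i c) //=; try lia.
rewrite addrCA; congr (_ + _).
  have := big_addn 0 (i + b)%N i xpredT G; rewrite add0n addKn => ->.
  by apply: eq_bigr => t _; rewrite addnC.
rewrite (@big_cat_nat _ _ _ i 0 a) //=; last by lia.
congr (_ + _).
  rewrite [RHS]big_mkcond; apply: eq_big_nat => j /andP[_ hj].
  by rewrite /outer hj (ltn_eqF hj).
rewrite [RHS]big_ltn_cond // eqxx /=.
rewrite [RHS]big_mkcond /=.
have -> : \sum_(i.+1 <= j < a) (if j != i then G (outer b i j) else 0) =
  \sum_(i.+1 <= j < a) G (j + b).-1.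
  apply: eq_big_nat => j /andP[hj _].
  by rewrite /outer ltnNge (ltnW hj) /= (gtn_eqF hj).
have := big_addn 0 c (i + b)%N xpredT G; rewrite add0n => ->.
have := big_addn 0 a i.+1 xpredT (fun j => G (j + b).-1); rewrite add0n => ->.
have -> : (c - (i + b))%N = (a - i.+1)%N by lia.
by apply: eq_bigr => j _; congr G; lia.
Qed.

Lemma sum_antisym n (F : 'I_n -> 'I_n -> V) :
  (forall i j : 'I_n, (i < j)%N -> F i j = - F j i) ->
  \sum_i \sum_j F i j = \sum_i F i i.
Proof.
move=> h.
have E i : \sum_j F i j = F i i +
    (\sum_(j < n | (i < j)%N) F i j + \sum_(j < n | (j < i)%N) F i j).
  rewrite (bigD1 i) //=; congr (_ + _).
  rewrite (bigID (fun j : 'I_n => (i < j)%N)) /=; congr (_ + _).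
    apply: eq_bigl => j; rewrite -val_eqE /=; lia.
  apply: eq_bigl => j; rewrite -val_eqE /=; lia.
rewrite (eq_bigr _ (fun i _ => E i)) !big_split /=.
rewrite -[RHS]addr0; congr (_ + _).
rewrite (exchange_big_dep xpredT) //= -big_split big1 // => i _.
rewrite -big_split /= big1 // => j hj.
by rewrite (h j i) // addNr.
Qed.
End SumLemmas.

Section Delta.
Variables (k : fieldType) (P : operad k) (m : P 1 true).
Notation dl := (@delta k P true m _ _ _ erefl).

Fact delta_lin n p : linear (fun z : P n p => dl z).
Proof.
move=> c x y; rewrite /delta compDr compZr scalerBr -!addrA; congr (_ + _).
rewrite (eq_bigr (fun i => c *: comp (ar1 n) (parC erefl) i x m +
  comp (ar1 n) (parC (erefl : ~~ p = true (+) p)) i y m)); last first.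
  by move=> i _; rewrite compDl compZl.
rewrite big_split /= -scaler_sumr scalerDr opprD addrCA; congr (_ + _).
by rewrite !scalerA mulrC.
Qed.

Fact delta_act n p (s : 'S_n) (z : P n p) : dl (act s z) = act s (dl z).
Proof.
rewrite /delta (linD (@act_lin _ _ _ _ _)) (linN (@act_lin _ _ _ _ _)) actZ.
rewrite (linS (@act_lin _ _ _ _ _)); congr (_ - _ *: _).
  rewrite -{1}[m]act1 (@comp_act _ _ _ _ _ _ _ _ _ _ _ 1%g s s) ?perm1 //.
  split=> [l v e|j v]; last by rewrite ord1 eqxx.
  by rewrite perm1 /= add0n; congr (val (s _)); apply: val_inj; exact: e.
rewrite [RHS](reindex_inj (@perm_inj _ s)) /=; apply: eq_bigr => i _.
rewrite -{1}[m]act1; apply: comp_act; split=> [l v|j v ne].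
  rewrite ord1 addn0 perm1 addn0 => e.
  by congr (val (s _)); apply: val_inj; exact: e.
have E b : outer 1 b j = j by rewrite /outer; case: ifP => //; lia.
have E' b : outer 1 b (s j) = s j by rewrite /outer; case: ifP => //; lia.
by rewrite E E' => e; congr (val (s _)); apply: val_inj; exact: e.
Qed.

Local Notation ct r := (parC (erefl (~~ r) : ~~ r = true (+) r)).

Fact delta_comp a b c p q r (ec : c.+1 = (a + b)%N) (er : r = p (+) q)
    (er1 : ~~ r = ~~ p (+) q) (er2 : ~~ r = p (+) ~~ q)
    (i : 'I_a) (x : P a p) (y : P b q) :
  dl (comp ec er i x y) =
  comp ec er1 i (dl x) y + (-1) ^+ p *: comp ec er2 i x (dl y).
Proof.
rewrite /delta /= !(compDl, compDr, compNl, compNr, compZl, compZr).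
have -> : comp ec er1 i (comp (erefl (1 + a)%N : a.+1 = (1 + a)%N)
    (erefl : ~~ p = true (+) p) ord0 m x) y =
  comp (erefl (1 + c)%N : c.+1 = (1 + c)%N) (erefl : ~~ r = true (+) r) ord0 m
    (comp ec er i x y) by apply: comp_seq.
rewrite -!addrA; congr (_ + _).
set xmy := comp ec er2 i x (comp _ _ ord0 m y).
have F0 (l : 'I_c) (t : 'I_b) : l = (i + t)%N :> nat ->
    comp (ar1 c) (ct r) l (comp ec er i x y) m =
    comp ec er2 i x (comp (ar1 b) (ct q) t y m).
  by move=> h; exact: comp_seq.
have F1 (l : 'I_c) (j : 'I_a) : j != i -> l = outer b i j :> nat ->
    comp (ar1 c) (ct r) l (comp ec er i x y) m =
    (-1) ^+ q *: comp ec er1 i (comp (ar1 a) (ct p) j x m) y.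
  rewrite /outer -val_eqE /= => ne; case: (ltnP j i) => [lt|le] e.
    rewrite (@comp_par _ P _ _ _ _ _ _ _ _ _ _ _ _ (ar1 a) (ct p) ec er1 ec er
      (ar1 c) (ct r) j i i l x m y) //; last by rewrite addn1.
    by rewrite scalerA -signr_addb addbb scale1r.
  rewrite (@comp_par _ P _ _ _ _ _ _ _ _ _ _ _ _ ec er (ar1 c) (ct r) (ar1 a)
    (ct p) ec er1 i j l i x y m) ?andbT //.
  by lia.
pose G v := if insub v is Some l then
  comp (ar1 c) (ct r) l (comp ec er i x y) m else 0.
have GE (l : 'I_c) : G l = comp (ar1 c) (ct r) l (comp ec er i x y) m.
  by rewrite /G valK.
rewrite -(eq_bigr _ (fun l _ => GE l)) (sum_block ec i).
rewrite (eq_bigr (fun t : 'I_b => comp ec er2 i x (comp (ar1 b) (ct q) t y m))); last first.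
  move=> t _; have lt : (i + t < c)%N by have := ltn_ord i; have := ltn_ord t; lia.
  by rewrite (GE (Ordinal lt)); exact: F0.
rewrite [X in _ *: (_ + X)](eq_bigr (fun j : 'I_a =>
  (-1) ^+ q *: comp ec er1 i (comp (ar1 a) (ct p) j x m) y)); last first.
  move=> j ne; have lt := outer_lt ec (ltn_ord i) (ltn_ord j) ne.
  by rewrite (GE (Ordinal lt)); exact: F1.
rewrite compSl compSr [X in - ((-1) ^+ p *: X) + _](bigD1 i) //=.
have -> : comp ec er1 i (comp (ar1 a) (ct p) i x m) y = xmy.
  by apply: comp_seq; rewrite addn0.
rewrite -scaler_sumr.
have -> : (-1) ^+ r = (-1) ^+ p * (-1) ^+ q :> k by rewrite er signr_addb.
set S1 := \sum_(t < b) _; set S2 := \sum_(j < a | _) _.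
have -> : ((-1) ^+ p * (-1) ^+ q) *: (S1 + (-1) ^+ q *: S2) =
    (-1) ^+ p *: ((-1) ^+ q *: S1) + (-1) ^+ p *: S2.
  by rewrite -scalerA scalerDr [_ *: (_ *: S2)]scalerA -signr_addb addbb scale1r scalerDr.
by rewrite scalerBr scalerDr !opprD addrACA addNr add0r addrC.
Qed.

Lemma delta_delta n p (e : ~~ ~~ p = false (+) p) (z : P n p) :
  dl (dl z) = delta (square m) e z.
Proof.
rewrite /delta /= expr0 scale1r !(compDl, compDr, compNl, compNr, compZl, compZr).
rewrite compSr.
have -> : \sum_(i < n) comp (ar1 n) (ct (~~ p)) i
    (comp (erefl (1 + n)%N : n.+1 = (1 + n)%N) (erefl (~~ p) : ~~ p = true (+) p) ord0 m z -
     (-1) ^+ p *: \sum_(j < n) comp (ar1 n) (ct p) j z m) m =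
  \sum_(i < n) comp (erefl (1 + n)%N : n.+1 = (1 + n)%N) erefl ord0 m
     (comp (ar1 n) (ct p) i z m) -
  (-1) ^+ p *: \sum_(i < n) comp (ar1 n) (parC e) i z (square m).
  rewrite (eq_bigr (fun i => comp (erefl (1 + n)%N : n.+1 = (1 + n)%N) erefl ord0 m
     (comp (ar1 n) (ct p) i z m) -
     (-1) ^+ p *: \sum_(j < n) comp (ar1 n) (ct (~~ p)) i (comp (ar1 n) (ct p) j z m) m)).
    rewrite sumrB -scaler_sumr; congr (_ - _ *: _).
    rewrite exchange_big (sum_antisym (F := fun j i =>
      comp (ar1 n) (ct (~~ p)) i (comp (ar1 n) (ct p) j z m) m)).
      by apply: eq_bigr => i _; apply: comp_seq; rewrite addn0.
    move=> i j lt.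
    rewrite (@comp_par _ P _ _ _ _ _ _ _ _ _ _ _ _ (ar1 n) (ct p)
      (ar1 n) (ct (~~ p)) (ar1 n) (ct p) (ar1 n) (ct (~~ p)) i j j i) ?addn1 //.
    by rewrite expr1 scaleN1r.
  move=> i _; rewrite compDl compNl compZl compSl; congr (_ - _).
  exact: comp_seq.
have -> : comp (erefl (1 + n)%N : n.+1 = (1 + n)%N) (erefl : ~~ ~~ p = true (+) ~~ p)
    ord0 m (comp (erefl (1 + n)%N : n.+1 = (1 + n)%N) (erefl : ~~ p = true (+) p) ord0 m z) =
  comp (erefl (1 + n)%N : n.+1 = (1 + n)%N) e ord0 (square m) z.
  by apply/esym; apply: comp_seq.
by rewrite signrN scaleNr opprK scalerBr scalerA -signr_addb addbb scale1r addrA subrK.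
Qed.
End Delta.

Section Twist.
Variables (k : fieldType) (P : dgOperad k) (m : P 1 true) (hm : MC m).

Definition twd n p (z : P n p) : P n (~~ p) :=
  dd z + delta m (erefl : ~~ p = true (+) p) z.

Lemma dd_delta n p (e : ~~ ~~ p = false (+) p) (z : P n p) :
  dd (delta m (erefl : ~~ p = true (+) p) z) =
  delta (dd m : P 1 false) e z - delta m erefl (dd z).
Proof.
rewrite /delta /= expr0 scale1r (linD (@dd_lin _ _ _ _)) (linN (@dd_lin _ _ _ _)).
rewrite (linZ (@dd_lin _ _ _ _)) (linS (@dd_lin _ _ _ _)).
rewrite (@dd_comp _ P 1 n n true p (~~ p) _ _ e (erefl : ~~ ~~ p = true (+) ~~ p)) expr1 scaleN1r.
rewrite (eq_bigr (fun i => comp (ar1 n) (parC (erefl : ~~ ~~ p = true (+) ~~ p)) i (dd z) m +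
   (-1) ^+ p *: comp (ar1 n) (parC e) i z (dd m : P 1 false))); last first.
  by move=> i _; rewrite (@dd_comp _ P n 1 n p true (~~ p) _ _
    (parC (erefl : ~~ ~~ p = true (+) ~~ p)) (parC e)).
rewrite big_split /= -scaler_sumr scalerDr scalerA -signr_addb addbb scale1r.
rewrite signrN scaleNr opprK !opprD -!addrA; congr (_ + _).
by rewrite [RHS]addrC -addrA.
Qed.

Fact twd_lin n p : linear (@twd n p).
Proof.
move=> c x y; rewrite /twd dd_lin (delta_lin m c x y).
by rewrite addrACA -scalerDr.
Qed.
Fact twd_twd n p (z : P n p) : twd (twd z) = 0.
Proof.
rewrite /twd (linD (@dd_lin _ _ _ _)) dd_dd add0r (linD (@delta_lin _ _ m _ _)).
have e : ~~ ~~ p = false (+) p by rewrite negbK.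
rewrite (dd_delta e) (delta_delta m e) addrA addrNK.
rewrite /delta /= expr0 !scale1r addrACA -opprD -big_split /= -compDl hm comp0l.
rewrite big1 ?subrr // => i _.
by rewrite -compDr hm comp0r.
Qed.
Fact twd_act n p (s : 'S_n) (z : P n p) : twd (act s z) = act s (twd z).
Proof. by rewrite /twd dd_act delta_act actD. Qed.
Fact twd_comp a b c p q r (ec : c.+1 = (a + b)%N) (er : r = p (+) q)
    (er1 : ~~ r = ~~ p (+) q) (er2 : ~~ r = p (+) ~~ q)
    (i : 'I_a) (x : P a p) (y : P b q) :
  twd (comp ec er i x y) =
  comp ec er1 i (twd x) y + (-1) ^+ p *: comp ec er2 i x (twd y).
Proof.
rewrite /twd (dd_comp ec er er1 er2) (delta_comp m ec er er1 er2).
by rewrite compDl compDr addrACA -scalerDr.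
Qed.

Definition twist : dgOperad k := DGOperad twd_lin twd_twd twd_act twd_comp.
End Twist.

Fact free_m_MC (k : fieldType) (O : dgOperad k) :
  MC (free_m O : free_dg O 1 true).
Proof. by rewrite /MC /= fder_m addNr. Qed.

Definition hat (k : fieldType) (O : dgOperad k) : dgOperad k :=
  twist (@free_m_MC k O).

(* Main.v *)
From mathcomp Require Import all_boot all_algebra all_fingroup zify boolp
  functions.
Require Import Defs.

Set Implicit Arguments.
Unset Strict Implicit.
Unset Printing Implicit Defensive.

Import GRing.Theory.
Local Open Scope ring_scope.

(** Let L ([strip]) remove an [m] at the root of an element of O[m], killing the
    composites rooted in O; it takes values in O[m] with a unit adjoined, as
    L m = 1. Then dL + Ld = - m L, and the extra term m z of the twisted
    differential D turns this into DL + LD = id, whence the acyclicity.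

    For the inclusion, view an element of O[m] as a combination of trees with
    vertices in O and powers of [m] on the edges (the root and the leaves
    included). Let H ([contract]) sum, over all edges, the removal of one [m]
    from the edge, and let Q_i ([leafproj]) project onto the trees whose i-th
    leaf carries an [m]. The recursion
      H (x o_i y) = H x o_i y +- (x o_i H y - Q_i x o_i L y)
    defines H without normal forms: the last term compensates for the edge at
    which x and y are glued. Then N = - (dH + Hd) counts the edges which carry
    an [m], so (N - 1) ... (N - M) x lies in O for some M. If x is a cycle, N x
    is a boundary, hence this element is homologous to (-1)^M M! x, and M! is
    invertible in characteristic 0. *)

(** * Transport between arities and parities *)

Section Recast.
Variables (k : fieldType) (P : operad k).

(* The identity where source and target agree, and zero elsewhere.            *)
Definition recast n p n' p' (x : P n p) : P n' p' :=
  match @eqP _ n n', @eqP _ p p' with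
  | ReflectT en, ReflectT ep => ecast n' (P n' p') en (ecast p' (P n p') ep x)
  | _, _ => 0
  end.

Lemma recast_id n p (x : P n p) : recast n p x = x.
Proof.
rewrite /recast; case: eqP => // en; case: eqP => // ep.
by rewrite (eq_axiomK en) (eq_axiomK ep).
Qed.

Lemma recast_ne n p n' p' (x : P n p) :
  ~~ ((n == n') && (p == p')) -> recast n' p' x = 0.
Proof. by rewrite /recast; case: eqP => // en; case: eqP => // ep. Qed.

Lemma recast_lin n p n' p' : linear (@recast n p n' p').
Proof.
move=> e x y; have [/andP[/eqP en /eqP ep]|ne] := boolP ((n == n') && (p ==
  p')).
  by subst n' p'; rewrite !recast_id.
by rewrite !recast_ne // scaler0 addr0.
Qed.

Lemma recastD n p n' p' (x y : P n p) :
  recast n' p' (x + y) = recast n' p' x + recast n' p' y.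
Proof. exact: linD (@recast_lin _ _ _ _) _ _. Qed.
Lemma recastZ n p n' p' e (x : P n p) :
  recast n' p' (e *: x) = e *: recast n' p' x.
Proof. exact: linZ (@recast_lin _ _ _ _) _ _. Qed.
Lemma recast0 n p n' p' : recast n' p' (0 : P n p) = 0.
Proof. exact: lin0 (@recast_lin _ _ _ _). Qed.
Lemma recastN n p n' p' (x : P n p) : recast n' p' (- x) = - recast n' p' x.
Proof. exact: linN (@recast_lin _ _ _ _) _. Qed.

Lemma recast_recast n p n1 p1 n2 p2 (x : P n p) :
  recast n2 p2 (recast n1 p1 x) =
  if (n == n1) && (p == p1) then recast n2 p2 x else 0.
Proof.
case: ifPn => [/andP[/eqP en /eqP ep]|ne].
  by subst n1 p1; rewrite recast_id.
by rewrite (recast_ne x ne) recast0.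
Qed.

(** With [b] and [q] fixed, [(a, p)] and [(c, r)] determine each other, so the two recasts are both
    identities or both zero. Hence the indices need to agree only when [a = a']. *)
Lemma recast_compl a b c p q r a' c' p' r' (ec : c.+1 = (a + b)%N)
    (er : r = p (+) q) (ec' : c'.+1 = (a' + b)%N) (er' : r' = p' (+) q)
    (i : 'I_a) (i' : 'I_a') (x : P a p) (y : P b q) :
  (a = a' -> i = i' :> nat) ->
  comp ec' er' i' (recast a' p' x) y = recast c' r' (comp ec er i x y).
Proof.
move=> ei; have [/andP[/eqP ea /eqP ep]|ne] := boolP ((a == a') && (p == p')).
  subst a' p'; have ecc : c = c' by lia.
  by subst c' r r'; rewrite !recast_id; apply: comp_irr; rewrite -?ei.
rewrite !recast_ne ?comp0l //; apply: contra ne.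
move=> /andP[/eqP e1 /eqP e2]; apply/andP; split; first by apply/eqP; lia.
by move: e2; rewrite er er' => /addIb ->.
Qed.

Lemma recast_compr a b c p q r b' c' q' r' (ec : c.+1 = (a + b)%N)
    (er : r = p (+) q) (ec' : c'.+1 = (a + b')%N) (er' : r' = p (+) q')
    (i i' : 'I_a) (x : P a p) (y : P b q) : i = i' :> nat ->
  comp ec' er' i' x (recast b' q' y) = recast c' r' (comp ec er i x y).
Proof.
move=> ei; have [/andP[/eqP ea /eqP ep]|ne] := boolP ((b == b') && (q == q')).
  subst b' q'; have ecc : c = c' by lia.
  by subst c' r r'; rewrite !recast_id; apply: comp_irr.
rewrite !recast_ne ?comp0r //; apply: contra ne.
move=> /andP[/eqP e1 /eqP e2]; apply/andP; split; first by apply/eqP; lia.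
by move: e2; rewrite er er' => /addbI ->.
Qed.

Lemma recast_act n p n' p' (s : 'S_n) (s' : 'S_n') (x : P n p) :
  (forall (v : 'I_n) (v' : 'I_n'), v = v' :> nat -> s v = s' v' :> nat) ->
  recast n' p' (act s x) = act s' (recast n' p' x).
Proof.
move=> h; have [/andP[/eqP en /eqP ep]|ne] := boolP ((n == n') && (p == p')).
  subst n' p'; rewrite !recast_id; congr act.
  by apply/permP => v; apply: val_inj; apply: h.
by rewrite !recast_ne // (lin0 (@act_lin _ _ _ _ _)).
Qed.
End Recast.

Lemma recast_dd (k : fieldType) (P : dgOperad k) n p n' p' (x : P n p) :
  dd (recast n' p' x) = recast n' (~~ p') (dd x).
Proof.
have [/andP[/eqP en /eqP ep]|ne] := boolP ((n == n') && (p == p')).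
  by subst n' p'; rewrite !recast_id.
rewrite !recast_ne ?(lin0 (@dd_lin _ _ _ _)) //.
by rewrite (inj_eq negb_inj).
Qed.

(** * Adjoining a unit to an operad *)

(* A unit is adjoined by letting [(0, 1)] in arity 1 and even parity act as   *)
(* the identity. The scalar components in other arities and parities are      *)
(* junk: every composition ignores them.                                      *)
Section Unital.
Variables (k : fieldType) (P : operad k).

Definition uobj n p : lmodType k := (P n p * k^o)%type.

Definition uact n p (s : 'S_n) (x : uobj n p) : uobj n p := (act s x.1, x.2).

(** The factors are read as [x.1 + x.2] and [y.1 + y.2]. As [y.1] fits into arity [c] and parity [r]
    only if [a = 1] and [p] is even, [recast] makes the scalar of [x] count only there; likewise for
    [y]. *)
Definition ucomp a b c p q r (ec : c.+1 = (a + b)%N) (er : r = p (+) q)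
    (i : 'I_a) (x : uobj a p) (y : uobj b q) : uobj c r :=
  (comp ec er i x.1 y.1 + (x.2 : k) *: recast c r y.1 + (y.2 : k) *: recast c r
    x.1,
   if [&& a == 1, b == 1, ~~ p & ~~ q]%N then x.2 * y.2 else 0).

Fact uact_lin n p (s : 'S_n) : linear (@uact n p s).
Proof. by move=> e x y; rewrite /uact act_lin. Qed.
Fact uact1 n p (x : uobj n p) : uact 1%g x = x.
Proof. by case: x => x c; rewrite /uact act1. Qed.
Fact uactM n p (s t : 'S_n) (x : uobj n p) :
  uact t (uact s x) = uact (t * s)%g x.
Proof. by rewrite /uact actM. Qed.

Fact ucomp_linl a b c p q r (ec : c.+1 = (a + b)%N) (er : r = p (+) q)
  (i : 'I_a) (y : uobj b q) : linear (fun x : uobj a p => ucomp ec er i x y).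
Proof.
move=> e [x al] [x' al']; case: y => y be; congr pair => /=.
  rewrite compDl compZl recastD recastZ !scalerDr scalerDl !scalerA.
  rewrite [be * e]mulrC.
  rewrite [LHS](AC (2*2*2) ((1*3*5)*(2*4*6))); congr (_ + _).
by case: ifP => _; rewrite ?scaler0 ?addr0 // mulrDl -mulrA.
Qed.
Fact ucomp_linr a b c p q r (ec : c.+1 = (a + b)%N) (er : r = p (+) q)
  (i : 'I_a) (x : uobj a p) : linear (fun y : uobj b q => ucomp ec er i x y).
Proof.
move=> e [y be] [y' be']; case: x => x al; congr pair => /=.
  rewrite compDr compZr recastD recastZ !scalerDr scalerDl !scalerA.
  rewrite [al * e]mulrC.
  by rewrite [LHS](AC (2*2*2) ((1*3*5)*(2*4*6))).
by case: ifP => _; rewrite ?scaler0 ?addr0 // mulrDr mulrCA.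
Qed.

Fact ucomp_act a b c p q r (ec : c.+1 = (a + b)%N) (er : r = p (+) q)
    (i : 'I_a) (s : 'S_a) (t : 'S_b) (u : 'S_c) (x : uobj a p) (y : uobj b q) :
  block_perm i s t u ->
  ucomp ec er i (uact s x) (uact t y) = uact u (ucomp ec er (s i) x y).
Proof.
move=> h; congr pair => /=; rewrite (comp_act _ _ _ _ h) !actD !actZ.
have [hi ho] := h.
have [ib sib] := (ltn_ord i, ltn_ord (s i)).
congr (_ + _ *: _ + _ *: _).
  (* If [b = c], then [a = 1] and [u] acts as [t]. For the last term, [a = c] gives [b = 1], and [u]
     acts as [s]. *)
  have [eb|ne] := eqVneq b c; last by rewrite !recast_ne ?(negbTE ne) ?(lin0
    (@act_lin _ _ _ _ _)).
  apply: recast_act => v v' ev; rewrite (hi v v'); last by lia.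
  lia.
have [eb|ne] := eqVneq a c; last by rewrite !recast_ne ?(negbTE ne) ?(lin0
  (@act_lin _ _ _ _ _)).
have b1 : b = 1%N by lia.
subst b; apply: recast_act => v v' ev.
have E w z : (w < a)%N -> (z < a)%N -> outer 1 w z = z by rewrite /outer;
  case: ifP; lia.
have [evi|nvi] := eqVneq v i.
  rewrite (hi ord0 v') ?evi; last by rewrite addn0 -ev evi.
  by rewrite ord1 /= addn0.
by rewrite (ho v v') // E // ?ltn_ord.
Qed.

Lemma recast_if n p n' p' (x : P n p) (c1 c2 : bool) :
  ((n == n') && (p == p') -> c1 = c2) ->
  (if c1 then recast n' p' x else 0) = if c2 then recast n' p' x else 0.
Proof.
case: (boolP ((n == n') && (p == p'))) => [_ -> //|ne _].
by rewrite recast_ne // !if_same.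
Qed.

Lemma scale_if (V : lmodType k) (b : bool) (e : k) (v : V) :
  (if b then e else 0) *: v = e *: (if b then v else 0).
Proof. by case: b; rewrite ?scale0r ?scaler0. Qed.

Fact ucomp_seq a b c ab bc abc p q r pq qr pqr
    (e1 : ab.+1 = (a + b)%N) (f1 : pq = p (+) q)
    (e2 : abc.+1 = (ab + c)%N) (f2 : pqr = pq (+) r)
    (e3 : bc.+1 = (b + c)%N) (f3 : qr = q (+) r)
    (e4 : abc.+1 = (a + bc)%N) (f4 : pqr = p (+) qr)
    (i : 'I_a) (j : 'I_b) (l : 'I_ab) (x : uobj a p) (y : uobj b q) (z : uobj c
      r) :
  l = (i + j)%N :> nat ->
  ucomp e2 f2 l (ucomp e1 f1 i x y) z = ucomp e4 f4 i x (ucomp e3 f3 j y z).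
Proof.
move=> el; case: x y z => [x al] [y be] [z ga].
have [ia jb] := (ltn_ord i, ltn_ord j).
congr pair => /=; last first.
  have if2 (c1 c2 : bool) (u v : k) :
      (if c1 then (if c2 then u else 0) * v else 0) = if c1 && c2 then u * v
        else 0.
    by case: c1; case: c2 => //=; rewrite mul0r.
  have if2' (c1 c2 : bool) (u v : k) :
      (if c1 then v * (if c2 then u else 0) else 0) = if c1 && c2 then v * u
        else 0.
    by case: c1; case: c2 => //=; rewrite mulr0.
  rewrite if2 if2' mulrA; congr (if _ then _ else _).
  (* Both guards say that all three arities are 1 and all three parities even. *)
  have [[a1 b1]|ne] : (a = 1 /\ b = 1)%N \/ ~ (a = 1 /\ b = 1)%N by lia.
    have -> : (ab == 1)%N by lia.
    have -> : (bc == 1)%N = (c == 1)%N by lia.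
    rewrite a1 b1 f1 f3; move: (c == 1)%N.
    by case: p q r {f1 f2 f3 f4 x y z} => [] [] [] [].
  by apply/idP/idP => h; lia.
rewrite !(recastD, recastZ, compDl, compDr, compZl, compZr, scalerDr) !scale_if.
rewrite (comp_seq e1 f1 e2 f2 e3 f3 e4 f4 _ _ _ el) !recast_recast.
(* Each side has seven terms, one for each nonempty set of factors contributing their operad
   component while the others contribute scalars. *)
rewrite [RHS](AC (3*3*1) (((1*4*2)*5)*((3*6)*7))) /= !scalerA.
congr (_ + _ *: _ + _ *: _ + _ *: _ + (_ *: _ + _ *: _ + _ *: _)) => //.
- by apply: recast_compl => eb; lia.
- have [eb|ne] := eqVneq b 1%N; last first.
    rewrite !recast_ne ?comp0l ?comp0r //.
      by apply: contra ne => /andP[/eqP h _]; apply/eqP; lia.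
    by apply: contra ne => /andP[/eqP h _]; apply/eqP; lia.
  have ec : ((a + c).-1.+1 = a + c)%N by lia.
  rewrite (recast_compl (i := i) ec (erefl (p (+) r)) e2 f2);
    last by move=> _; lia.
  by apply/esym; apply: recast_compr.
- apply: recast_if => h; apply/idP/idP => h'; lia.
- by apply/esym; apply: recast_compr.
- exact: mulrC.
- apply: recast_if => h; apply/idP/idP => h'; lia.
- exact: mulrC.
- apply: recast_if => h; apply/idP/idP => h'; lia.
Qed.

Fact ucomp_par a b c ab ac abc p q r pq pr pqr
    (e1 : ab.+1 = (a + b)%N) (f1 : pq = p (+) q)
    (e2 : abc.+1 = (ab + c)%N) (f2 : pqr = pq (+) r)
    (e3 : ac.+1 = (a + c)%N) (f3 : pr = p (+) r)
    (e4 : abc.+1 = (ac + b)%N) (f4 : pqr = pr (+) q)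
    (i j : 'I_a) (l : 'I_ab) (i' : 'I_ac)
    (x : uobj a p) (y : uobj b q) (z : uobj c r) :
  (i < j)%N -> l = (j + b).-1 :> nat -> i' = i :> nat ->
  ucomp e2 f2 l (ucomp e1 f1 i x y) z =
  (-1) ^+ (q && r) *: ucomp e4 f4 i' (ucomp e3 f3 j x z) y.
Proof.
move=> lij el ei; case: x y z => [x al] [y be] [z ga].
have [ia jb] := (ltn_ord i, ltn_ord j).
(* Two distinct inputs force [a > 1], so the scalar of [x] never counts. *)
have a1 : (a == 1%N) = false by apply/eqP; lia.
congr pair => /=; last first.
  by rewrite a1 /= !mul0r !if_same scaler0.
rewrite !a1 /= !scale0r !addr0.
rewrite !(recastD, recastZ, compDl, compZl, scalerDr).
rewrite (comp_par e1 f1 e2 f2 e3 f3 e4 f4 _ _ _ lij el ei).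
rewrite (recast_ne (n := b) (n' := ab));
  last by apply/negP => /andP[/eqP h _]; lia.
rewrite (recast_ne (n := c) (n' := ac));
  last by apply/negP => /andP[/eqP h _]; lia.
rewrite !(recast0, scaler0, comp0l, addr0, add0r) !recast_recast.
(* If [s'] is odd the recast vanishes; otherwise the sign is 1. *)
have sx d s s' s'' (w : P a p) : s = p (+) s' -> (-1) ^+ (s' && s'') *: recast
  d s w = recast d s w.
  case: s' => [->|_]; last by rewrite scale1r.
  by rewrite recast_ne ?scaler0 // addbT; case: (p); rewrite andbF.
have EA : (-1) ^+ (q && r) *: recast abc pqr (comp e3 f3 j x z) = comp e2 f2 l
  (recast ab pq x) z.
  by rewrite -(sx _ _ _ r _ f1) compZl; congr (_ *: _);
    apply/esym/recast_compl => h; lia.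
have EB : (-1) ^+ (q && r) *: comp e4 f4 i' (recast ac pr x) y = recast abc pqr
  (comp e1 f1 i x y).
  by rewrite andbC -compZl sx //; apply: recast_compl => h.
have ZC (e e' : k) (v : P abc pqr) : e *: (e' *: v) = e' *: (e *: v).
  by rewrite !scalerA mulrC.
rewrite [RHS](AC (2*2) ((1*3)*(2*4))) /=; congr (_ + _ + (_ + _)).
- by rewrite ZC EA.
- by rewrite ZC EB.
rewrite [LHS]ZC [RHS]ZC; congr (_ *: _); rewrite [RHS]ZC; congr (_ *: _).
have s1 : q = false -> (-1) ^+ (q && r) = 1 :> k by move->.
case: ifPn => h1; case: ifPn => h2.
- by rewrite s1 ?scale1r //; lia.
- by rewrite recast_ne ?scaler0 //; lia.
- by rewrite recast_ne ?scaler0 //; lia.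
- by rewrite scaler0.
Qed.

Definition unital : operad k :=
  @Operad k uobj uact ucomp uact_lin uact1 uactM ucomp_linl ucomp_linr ucomp_act
    ucomp_seq ucomp_par.

Definition uincl n p (x : P n p) : unital n p := (x, 0).
Definition unit1 : unital 1 false := (0, 1).

Fact uincl_lin n p : linear (@uincl n p).
Proof. by move=> e x y; congr pair; rewrite /= scaler0 addr0. Qed.
Fact uincl_act n p (s : 'S_n) (x : P n p) : uincl (act s x) = act s (uincl x).
Proof. by []. Qed.
Fact uincl_comp a b c p q r (ec : c.+1 = (a + b)%N) (er : r = p (+) q)
    (i : 'I_a) (x : P a p) (y : P b q) :
  uincl (comp ec er i x y) = comp ec er i (uincl x) (uincl y).
Proof. by congr pair; rewrite /= ?scale0r ?addr0 // mul0r if_same. Qed.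

Lemma recast_uincl n p n' p' (x : P n p) :
  recast n' p' (uincl x) = uincl (recast n' p' x).
Proof.
have [/andP[/eqP en /eqP ep]|ne] := boolP ((n == n') && (p == p')).
  by subst n' p'; rewrite !recast_id.
by rewrite !recast_ne.
Qed.

Lemma unit1l b c q r (ec : c.+1 = (1 + b)%N) (er : r = false (+) q) (i : 'I_1)
    (y : P b q) :
  comp ec er i unit1 (uincl y) = recast c r (uincl y).
Proof.
rewrite recast_uincl; congr pair; rewrite /= ?mulr0 ?if_same //.
by rewrite comp0l scale1r scale0r add0r addr0.
Qed.

Lemma unit1r a c p r (ec : c.+1 = (a + 1)%N) (er : r = p (+) false) (i : 'I_a)
    (x : P a p) :
  comp ec er i (uincl x) unit1 = recast c r (uincl x).
Proof.
rewrite recast_uincl; congr pair; rewrite /= ?mul0r ?if_same //.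
by rewrite comp0r scale1r scale0r !add0r.
Qed.
End Unital.

(** * The differential on the operad with unit *)

Section UnitalDG.
Variables (k : fieldType) (P : dgOperad k).

Definition udd n p (x : unital P n p) : unital P n (~~ p) := (dd x.1, 0).

Fact udd_lin n p : linear (@udd n p).
Proof. by move=> e x y; congr pair; rewrite /= ?dd_lin // scaler0 addr0. Qed.
Fact udd_udd n p (x : unital P n p) : udd (udd x) = 0.
Proof. by rewrite /udd /= dd_dd. Qed.
Fact udd_act n p (s : 'S_n) (x : unital P n p) : udd (act s x) = act s (udd x).
Proof. by rewrite /udd /= dd_act. Qed.
Fact udd_comp a b c p q r (ec : c.+1 = (a + b)%N) (er : r = p (+) q)
    (er1 : ~~ r = ~~ p (+) q) (er2 : ~~ r = p (+) ~~ q)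
    (i : 'I_a) (x : unital P a p) (y : unital P b q) :
  udd (comp ec er i x y) =
  comp ec er1 i (udd x) y + (-1) ^+ p *: comp ec er2 i x (udd y).
Proof.
case: x y => [x al] [y be]; congr pair => /=; last first.
  by rewrite mul0r mulr0 !if_same scaler0 addr0.
rewrite !(linD (@dd_lin _ _ _ _)) !(linZ (@dd_lin _ _ _ _)) !recast_dd.
rewrite (dd_comp ec er er1 er2) !scale0r !addr0 scalerDr -!addrA; congr (_ + _).
rewrite [RHS]addrCA; congr (_ + _); rewrite [LHS]addrC; congr (_ + _).
(* The sign on the term with the scalar of [x] is harmless: for odd [p] the recast vanishes. *)
case: p er er1 er2 x => er er1 er2 x; rewrite ?scale1r //.
by rewrite recast_ne ?scaler0 // er; case: (q); rewrite andbF.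
Qed.

Definition unital_dg : dgOperad k :=
  DGOperad udd_lin udd_udd udd_act udd_comp.

Lemma unit1_dd : dd (unit1 P : unital_dg 1 false) = 0.
Proof. by rewrite /= /udd (lin0 (@dd_lin _ _ _ _)). Qed.

End UnitalDG.

(** * Recursion on the free extension *)

Section Recursion.
Variables (k : fieldType) (O : operad k).
Notation A := (free_operad O).
Variables (V : nat -> bool -> lmodType k)
  (vact : forall n p, 'S_n -> V n p -> V n p)
  (vgen : forall n p, O n p -> V n p) (vm : V 1 true)
  (vcomp : forall a b c p q r, c.+1 = (a + b)%N -> r = p (+) q -> 'I_a ->
    A a p -> V a p -> A b q -> V b q -> V c r).

(* What recursion on terms needs to descend to the free extension, when the   *)
(* value on a composite may depend on the factors as well as on the values    *)
(* there.                                                                     *)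
Record compatible : Prop := Compatible {
  vact_lin : forall n p (s : 'S_n), linear (@vact n p s);
  vact1 : forall n p (x : V n p), vact 1%g x = x;
  vactM : forall n p (s t : 'S_n) (x : V n p),
    vact t (vact s x) = vact (t * s)%g x;
  vgen_lin : forall n p, linear (@vgen n p);
  vgen_act : forall n p (s : 'S_n) (x : O n p),
    vgen (act s x) = vact s (vgen x);
  vgen_comp : forall a b c p q r (ec : c.+1 = (a + b)%N) (er : r = p (+) q)
      (i : 'I_a) (x : O a p) (y : O b q),
    vgen (comp ec er i x y) =
    vcomp ec er i (free_incl O _ _ x) (vgen x) (free_incl O _ _ y) (vgen y);
  vcomp_linl : forall a b c p q r (ec : c.+1 = (a + b)%N) (er : r = p (+) q)
      (i : 'I_a) e x x' X X' y Y,
    vcomp ec er i (e *: x + x') (e *: X + X') y Y =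
    e *: vcomp ec er i x X y Y + vcomp ec er i x' X' y Y;
  vcomp_linr : forall a b c p q r (ec : c.+1 = (a + b)%N) (er : r = p (+) q)
      (i : 'I_a) e x X y y' Y Y',
    vcomp ec er i x X (e *: y + y') (e *: Y + Y') =
    e *: vcomp ec er i x X y Y + vcomp ec er i x X y' Y';
  vcomp_act : forall a b c p q r (ec : c.+1 = (a + b)%N) (er : r = p (+) q)
      (i : 'I_a) (s : 'S_a) (t : 'S_b) (u : 'S_c) x X y Y,
    block_perm i s t u ->
    vcomp ec er i (act s x) (vact s X) (act t y) (vact t Y) =
    vact u (vcomp ec er (s i) x X y Y);
  vcomp_seq : forall a b c ab bc abc p q r pq qr pqr
      (e1 : ab.+1 = (a + b)%N) (f1 : pq = p (+) q)
      (e2 : abc.+1 = (ab + c)%N) (f2 : pqr = pq (+) r)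
      (e3 : bc.+1 = (b + c)%N) (f3 : qr = q (+) r)
      (e4 : abc.+1 = (a + bc)%N) (f4 : pqr = p (+) qr)
      (i : 'I_a) (j : 'I_b) (l : 'I_ab) x X y Y z Z,
    l = (i + j)%N :> nat ->
    vcomp e2 f2 l (comp e1 f1 i x y) (vcomp e1 f1 i x X y Y) z Z =
    vcomp e4 f4 i x X (comp e3 f3 j y z) (vcomp e3 f3 j y Y z Z);
  vcomp_par : forall a b c ab ac abc p q r pq pr pqr
      (e1 : ab.+1 = (a + b)%N) (f1 : pq = p (+) q)
      (e2 : abc.+1 = (ab + c)%N) (f2 : pqr = pq (+) r)
      (e3 : ac.+1 = (a + c)%N) (f3 : pr = p (+) r)
      (e4 : abc.+1 = (ac + b)%N) (f4 : pqr = pr (+) q)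
      (i j : 'I_a) (l : 'I_ab) (i' : 'I_ac) x X y Y z Z,
    (i < j)%N -> l = (j + b).-1 :> nat -> i' = i :> nat ->
    vcomp e2 f2 l (comp e1 f1 i x y) (vcomp e1 f1 i x X y Y) z Z =
    (-1) ^+ (q && r) *:
      vcomp e4 f4 i' (comp e3 f3 j x z) (vcomp e3 f3 j x X z Z) y Y
}.

Hypothesis vP : compatible.

Fixpoint trec n p (t : term O n p) : V n p :=
  match t in term _ n p return V n p with
  | Tgen _ _ x => vgen x
  | Tm => vm
  | Tzero _ _ => 0
  | Tadd _ _ x y => trec x + trec y
  | Tscale _ _ c x => c *: trec x
  | Tact _ _ s x => vact s (trec x)
  | Tcomp _ _ _ _ _ _ ec er i x y =>
      vcomp ec er i (cls x : A _ _) (trec x) (cls y : A _ _) (trec y)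
  end.

Let clsDA n p (x y : term O n p) :
  (cls (Tadd x y) : A n p) = (cls x : A n p) + cls y.
Proof. exact: clsD. Qed.
Let clsZA n p c (x : term O n p) : (cls (Tscale c x) : A n p) = c *: (cls x : A
  n p).
Proof. exact: clsZ. Qed.
Let clsAA n p s (x : term O n p) : (cls (Tact s x) : A n p) = act s (cls x : A
  n p).
Proof. exact: cls_act. Qed.
Let clsCA a b c p q r (ec : c.+1 = (a + b)%N) (er : r = p (+) q)
    (i : 'I_a) (x : term O a p) (y : term O b q) :
  (cls (Tcomp ec er i x y) : A c r) =
  comp ec er i (cls x : A a p) (cls y : A b q).
Proof. exact: cls_comp. Qed.
Let clsEA := (clsDA, clsZA, clsAA, clsCA).

Lemma trec_eqt n p (x y : term O n p) : eqt x y -> trec x = trec y.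
Proof.
elim=> {n p x y} //=; intros; try congruence.
- by move/clsP: H => ->; move/clsP: H1 => ->; congr vcomp.
- by rewrite addrA.
- by rewrite addrC.
- by rewrite add0r.
- by rewrite scaleN1r addNr.
- by rewrite scalerA.
- by rewrite scale1r.
- by rewrite scalerDr.
- by rewrite scalerDl.
- exact: vact_lin.
- exact: vact1.
- exact: vactM.
- by rewrite !clsEA; exact: vcomp_linl.
- by rewrite !clsEA; exact: vcomp_linr.
- by rewrite !clsEA; exact: vcomp_act.
- by rewrite !clsEA; exact: vcomp_seq.
- by rewrite !clsEA; exact: vcomp_par.
- exact: vgen_lin.
- exact: vgen_act.
- exact: vgen_comp.
Qed.

Definition frec n p (x : A n p) : V n p := trec (rep x).

Lemma frec_cls n p (x : term O n p) : frec (cls x) = trec x.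
Proof. exact/trec_eqt/eqt_rep. Qed.

Lemma frec_lin n p : linear (@frec n p).
Proof.
move=> c x y; have := frec_cls (Tadd (Tscale c (rep x)) (rep y)).
by rewrite !clsEA /= !repK.
Qed.
Lemma frec_act n p (s : 'S_n) (x : A n p) : frec (act s x) = vact s (frec x).
Proof. by have := frec_cls (Tact s (rep x)); rewrite !clsEA /= !repK. Qed.
Lemma frec_comp a b c p q r (ec : c.+1 = (a + b)%N) (er : r = p (+) q)
    (i : 'I_a) (x : A a p) (y : A b q) :
  frec (comp ec er i x y) = vcomp ec er i x (frec x) y (frec y).
Proof.
by have := frec_cls (Tcomp ec er i (rep x) (rep y)); rewrite !clsEA /= !repK.
Qed.
Lemma frec_incl n p (x : O n p) : frec (free_incl O n p x) = vgen x.
Proof. exact: (frec_cls (Tgen x)). Qed.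
Lemma frec_m : frec (free_m O) = vm.
Proof. exact: (frec_cls (Tm O)). Qed.
End Recursion.

Lemma act_0 (k : fieldType) (P : operad k) n p (s : 'S_n) : act s (0 : P n p) =
  0.
Proof. exact: lin0 (@act_lin _ _ _ _ _). Qed.
Lemma actN (k : fieldType) (P : operad k) n p (s : 'S_n) (x : P n p) :
  act s (- x) = - act s x.
Proof. exact: linN (@act_lin _ _ _ _ _) _. Qed.

(** * Removing [m] at the root *)

Section RootStrip.
Variables (k : fieldType) (O : operad k).
Notation A := (free_operad O).
Notation B := (unital A).

Let vstrip (a b c : nat) (p q r : bool) (ec : c.+1 = (a + b)%N)
    (er : r = p (+) q)
    (i : 'I_a) (x : A a p) (X : B a (~~ p)) (y : A b q) (Y : B b (~~ q)) :
    B c (~~ r) :=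
  comp ec (parNl er) i X (uincl y).

(** The right factor enters only through its inclusion: the recursion describes a map of right
    modules, so the conditions reduce to the axioms of the operad with unit. *)
Fact strip_compatible : compatible (V := fun n p => B n (~~ p))
  (fun n p => @act _ B n (~~ p)) (fun n p (x : O n p) => 0) vstrip.
Proof.
split; rewrite /vstrip.
- by move=> n p s; exact: act_lin.
- by move=> n p x; exact: act1.
- by move=> n p s t x; exact: actM.
- by move=> n p e x y; rewrite scaler0 addr0.
- by move=> n p s x; rewrite act_0.
- by intros; rewrite comp0l.
- by intros; exact: comp_linl.
- by intros; rewrite uincl_lin; exact: comp_linr.
- by intros; rewrite uincl_act; exact: comp_act.
- by intros; rewrite uincl_comp; exact: comp_seq.
- by intros; exact: comp_par.
Qed.

(* Removes an [m] at the root: [m o x] is sent to [x], and every composite    *)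
(* whose root is in [O] to zero.                                              *)
Definition strip n p (x : A n p) : B n (~~ p) :=
  frec (fun n p => @act _ B n (~~ p)) (fun n p (x : O n p) => 0)
    (unit1 A) vstrip x.

Lemma strip_lin n p : linear (@strip n p).
Proof. exact: (@frec_lin k O _ _ _ (unit1 A) _ strip_compatible). Qed.
Lemma strip_act n p (s : 'S_n) (x : A n p) : strip (act s x) = act s (strip x).
Proof. exact: (@frec_act k O _ _ _ (unit1 A) _ strip_compatible). Qed.
Lemma strip_comp a b c p q r (ec : c.+1 = (a + b)%N) (er : r = p (+) q)
    (i : 'I_a) (x : A a p) (y : A b q) :
  strip (comp ec er i x y) = comp ec (parNl er) i (strip x) (uincl y).
Proof. exact: (@frec_comp k O _ _ _ (unit1 A) _ strip_compatible). Qed.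
Lemma strip_incl n p (x : O n p) : strip (free_incl O n p x) = 0.
Proof. exact: (@frec_incl k O _ _ _ (unit1 A) _ strip_compatible). Qed.
Lemma strip_m : strip (free_m O) = unit1 A.
Proof. exact: (@frec_m k O _ _ _ (unit1 A) _ strip_compatible). Qed.
End RootStrip.

(** * Projections onto trees with an [m] at a given leaf *)

Section LeafProjection.
Variables (k : fieldType) (O : operad k).
Notation A := (free_operad O).

(** Extending by the identity lets leaves be indexed by plain numbers, without bounds to carry
    along. *)
Definition natperm n (s : 'S_n) (v : nat) : nat := oapp (fun j =>
  val (s j)) v (insub v).

Lemma natperm_ord n (s : 'S_n) (j : 'I_n) (v : nat) : v = j :> nat -> natperm s
  v = s j.
Proof. by move->; rewrite /natperm valK. Qed.

Lemma natperm_ge n (s : 'S_n) (v : nat) : (n <= v)%N -> natperm s v = v.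
Proof. by move=> h; rewrite /natperm insubF // ltnNge h. Qed.

(* The inputs not smaller than the arity index nothing: the projections are   *)
(* zero there.                                                                *)
Let V n p : lmodType k := (nat -> A n p)%type.
Let vact n p (s : 'S_n) (X : V n p) : V n p := fun v => act s (X (natperm s v)).
(** The three cases invert the numbering [outer]. An index [v >= c] falls into the last one and
    becomes an index [>= a] of [x], so out-of-range indices stay out of range. *)
Let vcomp (a b c : nat) (p q r : bool) (ec : c.+1 = (a + b)%N)
    (er : r = p (+) q)
    (i : 'I_a) (x : A a p) (X : V a p) (y : A b q) (Y : V b q) : V c r :=
  fun v => if (v < i)%N then comp ec er i (X v) y
    else if (v < i + b)%N then comp ec er i x (Y (v - i)%N)
    else comp ec er i (X (v.+1 - b)%N) y.
Let vm : V 1 true := fun v => if v is 0 then free_m O else 0.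

Fact leaf_compatible : compatible vact (fun n p (x : O n p) => 0) vcomp.
Proof.
split; rewrite /vact /vcomp.
- by move=> n p s e x y; apply: funext => v; exact: act_lin.
- move=> n p x; apply: funext => v; rewrite act1; congr (x _).
  have [h|h] := leqP n v; first by rewrite natperm_ge.
  by rewrite (@natperm_ord _ _ (Ordinal h)) // perm1.
- move=> n p s t x; apply: funext => v; rewrite actM; congr (act _ (x _)).
  have [h|h] := leqP n v; first by rewrite !natperm_ge.
  rewrite (@natperm_ord _ t (Ordinal h)) // (@natperm_ord _ s (t (Ordinal h)))
    //.
  by rewrite (@natperm_ord _ _ (Ordinal h)) // permM.
- by move=> n p e x y; apply: funext => v; rewrite /= scaler0 addr0.
- by move=> n p s x; apply: funext => v; rewrite act_0.
- by intros; apply: funext => v; rewrite !comp0l comp0r !if_same.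
- move=> a b c p q r ec er i e x x' X X' y Y; apply: funext => v; rewrite !fctE.
  case: ifP => _; [|case: ifP => _]; exact: comp_linl.
- move=> a b c p q r ec er i e x X y y' Y Y'; apply: funext => v; rewrite !fctE.
  case: ifP => _; [|case: ifP => _]; exact: comp_linr.
- move=> a b c p q r ec er i s t u x X y Y h; apply: funext => v.
  have [hi ho] := h; have [ia sia] := (ltn_ord i, ltn_ord (s i)).
  have [vc|vc] := leqP c v.
    rewrite !(natperm_ge (n := c)) //.
    repeat (case: ifP; try lia) => *.
    by rewrite natperm_ge ?(comp_act _ _ _ _ h) //; lia.
  rewrite (@natperm_ord _ _ (Ordinal vc)) //.
  have [vi|vi] := ltnP v i.
    have va : (v < a)%N by lia.
    rewrite (@natperm_ord _ _ (Ordinal va)) //.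
    have ew : u (Ordinal vc) = outer b (s i) (s (Ordinal va)) :> nat.
      by apply: ho; rewrite -?val_eqE /= /outer ?vi; lia.
    have ne : s (Ordinal va) != s i :> nat.
      by rewrite val_eqE (inj_eq perm_inj) -val_eqE /=; lia.
    (* The permutation [s] may carry this input to either side of the block glued in at [s i]. *)
    have [[lt ew']|[gt ew']] : (s (Ordinal va) < s i /\ u (Ordinal vc) = s
      (Ordinal va) :> nat \/
        s i < s (Ordinal va) /\ u (Ordinal vc) = (s (Ordinal va) + b).-1 :>
          nat)%N.
    - by rewrite ew /outer; case: ltnP; lia.
    - by repeat (case: ifP; try lia) => *; rewrite (comp_act _ _ _ _ h) ew'.
    - repeat (case: ifP; try lia) => *; rewrite (comp_act _ _ _ _ h).
      by congr (act _ (comp _ _ _ (X _) _)); lia.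
  have [vib|vib] := ltnP v (i + b).
    have vb : (v - i < b)%N by lia.
    rewrite (@natperm_ord _ _ (Ordinal vb)) //.
    have -> : u (Ordinal vc) = (s i + t (Ordinal vb))%N :> nat by apply: hi =>
      /=; lia.
    have tb := ltn_ord (t (Ordinal vb)).
    do 2?[case: ifP; try lia] => *.
    by rewrite (comp_act _ _ _ _ h); congr (act _ (comp _ _ _ _ (Y _))); lia.
  have va : (v.+1 - b < a)%N by lia.
  rewrite (@natperm_ord _ _ (Ordinal va)) //.
  have ew : u (Ordinal vc) = outer b (s i) (s (Ordinal va)) :> nat.
    by apply: ho; rewrite -?val_eqE /= /outer; [lia|case: ifP; lia].
  have ne : s (Ordinal va) != s i :> nat.
    by rewrite val_eqE (inj_eq perm_inj) -val_eqE /=; lia.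
  have [[lt ew']|[gt ew']] : (s (Ordinal va) < s i /\ u (Ordinal vc) = s
    (Ordinal va) :> nat \/
      s i < s (Ordinal va) /\ u (Ordinal vc) = (s (Ordinal va) + b).-1 :>
        nat)%N.
  - by rewrite ew /outer; case: ltnP; lia.
  - by repeat (case: ifP; try lia) => *; rewrite (comp_act _ _ _ _ h) ew'.
  - repeat (case: ifP; try lia) => *; rewrite (comp_act _ _ _ _ h).
    by congr (act _ (comp _ _ _ (X _) _)); lia.
- move=> a b c ab bc abc p q r pq qr pqr e1 f1 e2 f2 e3 f3 e4 f4 i j l x X y Y
  z Z el.
  apply: funext => v; have [ia jb] := (ltn_ord i, ltn_ord j).
  have S x' y' z' := comp_seq e1 f1 e2 f2 e3 f3 e4 f4 x' y' z' el.
  repeat (case: ifP; try lia) => *; rewrite S;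
    first [by congr (comp _ _ _ (X _) _); lia
         | by congr (comp _ _ _ _ (comp _ _ _ (Y _) _)); lia
         | by congr (comp _ _ _ _ (comp _ _ _ _ (Z _))); lia].
- move=> a b c ab ac abc p q r pq pr pqr e1 f1 e2 f2 e3 f3 e4 f4 i j l i'.
  move=> x X y Y z Z lij el ei; apply: funext => v.
  have [ia jb] := (ltn_ord i, ltn_ord j).
  have S x' y' z' := comp_par e1 f1 e2 f2 e3 f3 e4 f4 x' y' z' lij el ei.
  rewrite scalrfctE; repeat (case: ifP; try lia) => *; rewrite S;
    first [by congr (_ *: comp _ _ _ (comp _ _ _ (X _) _) _); lia
         | by congr (_ *: comp _ _ _ (comp _ _ _ _ (Z _)) _); lia
         | by congr (_ *: comp _ _ _ _ (Y _)); lia].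
Qed.

(* The projection onto the part in which the input [v] is the input of an     *)
(* [m].                                                                       *)
Definition leafproj (v : nat) n p (x : A n p) : A n p :=
  frec vact (fun n p (x : O n p) => 0) vm vcomp x v.

Lemma leafproj_lin v n p : linear (@leafproj v n p).
Proof.
by move=> e x y; rewrite /leafproj (@frec_lin k O _ _ _ vm _ leaf_compatible).
Qed.
Lemma leafproj_act v n p (s : 'S_n) (x : A n p) :
  leafproj v (act s x) = act s (leafproj (natperm s v) x).
Proof.
by rewrite /leafproj (@frec_act k O _ _ _ vm _ leaf_compatible).
Qed.
Lemma leafproj_comp v a b c p q r (ec : c.+1 = (a + b)%N) (er : r = p (+) q)
    (i : 'I_a) (x : A a p) (y : A b q) :
  leafproj v (comp ec er i x y) =
  if (v < i)%N then comp ec er i (leafproj v x) y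
  else if (v < i + b)%N then comp ec er i x (leafproj (v - i) y)
  else comp ec er i (leafproj (v.+1 - b) x) y.
Proof.
by rewrite /leafproj (@frec_comp k O _ _ _ vm _ leaf_compatible).
Qed.
Lemma leafproj_incl v n p (x : O n p) : leafproj v (free_incl O n p x) = 0.
Proof.
by rewrite /leafproj (@frec_incl k O _ _ _ vm _ leaf_compatible).
Qed.
Lemma leafproj_m v : leafproj v (free_m O) = if v is 0 then free_m O else 0.
Proof. by rewrite /leafproj (@frec_m k O _ _ _ vm _ leaf_compatible). Qed.
End LeafProjection.

Section LeafProjectionComp.
Variables (k : fieldType) (O : operad k).
Notation A := (free_operad O).
Variables (a b c : nat) (p q r : bool).
Variables (ec : c.+1 = (a + b)%N) (er : r = p (+) q) (i : 'I_a).
Variables (x : A a p) (y : A b q).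

Lemma leafproj_comp_lt v : (v < i)%N ->
  leafproj v (comp ec er i x y) = comp ec er i (leafproj v x) y.
Proof. by rewrite leafproj_comp => ->. Qed.

Lemma leafproj_comp_in v (j : 'I_b) : v = (i + j)%N ->
  leafproj v (comp ec er i x y) = comp ec er i x (leafproj j y).
Proof.
by move->; rewrite leafproj_comp ltnNge leq_addr ltn_add2l ltn_ord addKn.
Qed.

Lemma leafproj_comp_out v j : (i < j)%N -> v = (j + b).-1 ->
  leafproj v (comp ec er i x y) = comp ec er i (leafproj j x) y.
Proof.
move=> h ->; rewrite leafproj_comp ifF ?ifF; try lia.
by congr (comp _ _ _ (leafproj _ _) _); lia.
Qed.
End LeafProjectionComp.

(** * Contraction of edges *)

Section EdgeContraction.
Variables (k : fieldType) (O : operad k).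
Notation A := (free_operad O).
Notation B := (unital A).

Let V n p := B n (~~ p).
(** If the leaf [i] of [x] and the root of [y] both carry an [m], gluing merges two marked edges
    into one, from which an [m] would be removed once through [x] and once through [y]. This is the
    surplus contribution of the root of [y]. *)
Let corr (a b c : nat) (p q r : bool) (ec : c.+1 = (a + b)%N) (er : r = p (+) q)
    (i : 'I_a) (x : A a p) (y : A b q) : B c (~~ r) :=
  comp ec (parNr er) i (uincl (leafproj i x)) (strip y).
Let vcomp (a b c : nat) (p q r : bool) (ec : c.+1 = (a + b)%N)
    (er : r = p (+) q)
    (i : 'I_a) (x : A a p) (X : V a p) (y : A b q) (Y : V b q) : V c r :=
  comp ec (parNl er) i X (uincl y) + (-1) ^+ p *: comp ec (parNr er) i (uincl
    x) Y
  - (-1) ^+ p *: corr ec er i x y.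

Fact corr_linl a b c p q r (ec : c.+1 = (a + b)%N) (er : r = p (+) q)
    (i : 'I_a) (y : A b q) : linear (fun x : A a p => corr ec er i x y).
Proof. by move=> e x x'; rewrite /corr leafproj_lin uincl_lin;
  exact: comp_linl. Qed.
Fact corr_linr a b c p q r (ec : c.+1 = (a + b)%N) (er : r = p (+) q)
    (i : 'I_a) (x : A a p) : linear (fun y : A b q => corr ec er i x y).
Proof. by move=> e y y'; rewrite /corr strip_lin; exact: comp_linr. Qed.

Fact corr_act a b c p q r (ec : c.+1 = (a + b)%N) (er : r = p (+) q)
    (i : 'I_a) (s : 'S_a) (t : 'S_b) (u : 'S_c) (x : A a p) (y : A b q) :
  block_perm i s t u ->
  corr ec er i (act s x) (act t y) = act u (corr ec er (s i) x y).
Proof.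
move=> h; rewrite /corr leafproj_act (@natperm_ord _ _ i) // uincl_act
  strip_act.
exact: comp_act.
Qed.

(** Apart from [corr], the conditions are those for a derivation, settled by [der_seq] and its
    companions. What remains is to match the correction terms, one for each of the two gluings. *)
Fact edge_compatible : compatible (V := V)
  (fun n p => @act _ B n (~~ p)) (fun n p (x : O n p) => 0) vcomp.
Proof.
have LC (U : lmodType k) e s (D1 D2 C1 C2 : U) :
    e *: D1 + D2 - s *: (e *: C1 + C2) = e *: (D1 - s *: C1) + (D2 - s *: C2).
  rewrite scalerBr scalerDr opprD !scalerA [s * e]mulrC.
  by rewrite [LHS](AC (2*2) ((1*3)*(2*4))).
have R1 (U : zmodType) (x y z t : U) : x - y + z - t = x + z + (- y - t).
  by rewrite -addrA addrACA.
have R2 (U : zmodType) (x y z t : U) : x + (y - z) - t = x + y + (- z - t).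
  by rewrite !addrA.
split; rewrite /vcomp /V.
- by move=> n p s; exact: act_lin.
- by move=> n p x; exact: act1.
- by move=> n p s t x; exact: actM.
- by move=> n p e x y; rewrite scaler0 addr0.
- by move=> n p s x; rewrite act_0.
- by intros; rewrite /corr strip_incl !comp0r comp0l !scaler0 !addr0 subr0.
- intros; rewrite uincl_lin (@der_linl _ B) corr_linl; exact: LC.
- intros; rewrite uincl_lin (@der_linr _ B) corr_linr; exact: LC.
- intros; rewrite !uincl_act (@der_act _ B _ _ _ _ _ _ _ _ _ _ _ u) //.
  by rewrite (@corr_act _ _ _ _ _ _ _ _ _ _ _ u) // !(actD, actN, actZ).
- move=> a b c ab bc abc p q r pq qr pqr e1 f1 e2 f2 e3 f3 e4 f4 i j l x X y Y
  z Z el.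
  have := @der_seq _ B _ _ _ _ _ _ _ _ _ _ _ _ e1 f1 e2 f2 e3 f3 e4 f4 i j l
    (uincl x) (uincl y) (uincl z) X Y Z el.
  rewrite -!uincl_comp => D.
  have BL (U W : B ab (~~ pq)) : comp e2 (parNl f2) l (U - W) (uincl z) =
      comp e2 (parNl f2) l U (uincl z) - comp e2 (parNl f2) l W (uincl z).
    by rewrite compDl compNl.
  have BR (U W : B bc (~~ qr)) : comp e4 (parNr f4) i (uincl x) (U - W) =
      comp e4 (parNr f4) i (uincl x) U - comp e4 (parNr f4) i (uincl x) W.
    by rewrite compDr compNr.
  rewrite BL BR scalerBr R1 R2.
  rewrite D; congr (_ + _); rewrite -!opprD; congr (- _).
  have [ia jb] := (ltn_ord i, ltn_ord j).
  (* The leaf [l] of [x o_i y] is the leaf [j] of [y], and stripping [y o_j z] only affects [y]; so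
     both bracketings yield the same two corrections. *)
  rewrite /corr (leafproj_comp_in e1 f1 x y el) strip_comp.
  rewrite compZl compZr !uincl_comp.
  rewrite (@comp_seq _ B _ _ _ _ _ _ _ _ _ _ _ _ e1 (parNr f1) e2 (parNl f2)
    e3 (parNl f3) e4 (parNr f4) i j l) //.
  rewrite (@comp_seq _ B _ _ _ _ _ _ _ _ _ _ _ _ e1 f1 e2 (parNr f2)
    e3 (parNr f3) e4 (parNr f4) i j l) //.
  have -> : (-1) ^+ pq = (-1) ^+ p * (-1) ^+ q :> k by rewrite f1 signr_addb.
  by rewrite addrC scalerA.
- move=> a b c ab ac abc p q r pq pr pqr e1 f1 e2 f2 e3 f3 e4 f4 i j l i'.
  move=> x X y Y z Z lij el ei.
  have := @der_par _ B _ _ _ _ _ _ _ _ _ _ _ _ e1 f1 e2 f2 e3 f3 e4 f4 i j l i'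
    (uincl x) (uincl y) (uincl z) X Y Z lij el ei.
  rewrite -!uincl_comp => D.
  have BL (U W : B ab (~~ pq)) : comp e2 (parNl f2) l (U - W) (uincl z) =
      comp e2 (parNl f2) l U (uincl z) - comp e2 (parNl f2) l W (uincl z).
    by rewrite compDl compNl.
  have BR (U W : B ac (~~ pr)) : comp e4 (parNl f4) i' (U - W) (uincl y) =
      comp e4 (parNl f4) i' U (uincl y) - comp e4 (parNl f4) i' W (uincl y).
    by rewrite compDl compNl.
  rewrite BL BR !R1 D [RHS]scalerDr; congr (_ + _).
  rewrite -!opprD scalerN; congr (- _).
  rewrite /corr (leafproj_comp_out e1 f1 x y lij el) (leafproj_comp_lt e3 f3 x
    z) ?ei //.
  rewrite !uincl_comp !compZl.
  rewrite (@comp_par _ B _ _ _ _ _ _ _ _ _ _ _ _ e1 (parNr f1) e2 (parNl f2) e3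
    f3 e4 (parNr f4) i j l i') //.
  rewrite (@comp_par _ B _ _ _ _ _ _ _ _ _ _ _ _ e1 f1 e2 (parNr f2) e3 (parNr
    f3) e4 (parNl f4) i j l i') //.
  rewrite scalerDr !scalerA (sgn1 _ _ f1) (sgn2 _ _ f3); exact: addrC.
Qed.

(* The sum over all edges of the removal of one [m] from the edge.            *)
Definition contract n p (x : A n p) : B n (~~ p) :=
  frec (fun n p => @act _ B n (~~ p)) (fun n p (x : O n p) => 0)
    (unit1 A) vcomp x.

Lemma contract_lin n p : linear (@contract n p).
Proof. exact: (@frec_lin k O _ _ _ (unit1 A) _ edge_compatible). Qed.
Lemma contract_act n p (s : 'S_n) (x : A n p) :
  contract (act s x) = act s (contract x).
Proof. exact: (@frec_act k O _ _ _ (unit1 A) _ edge_compatible). Qed.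
Lemma contract_comp a b c p q r (ec : c.+1 = (a + b)%N) (er : r = p (+) q)
    (i : 'I_a) (x : A a p) (y : A b q) :
  contract (comp ec er i x y) =
  comp ec (parNl er) i (contract x) (uincl y) +
  (-1) ^+ p *: comp ec (parNr er) i (uincl x) (contract y) -
  (-1) ^+ p *: comp ec (parNr er) i (uincl (leafproj i x)) (strip y).
Proof. exact: (@frec_comp k O _ _ _ (unit1 A) _ edge_compatible). Qed.
Lemma contract_incl n p (x : O n p) : contract (free_incl O n p x) = 0.
Proof. exact: (@frec_incl k O _ _ _ (unit1 A) _ edge_compatible). Qed.
Lemma contract_m : contract (free_m O) = unit1 A.
Proof. exact: (@frec_m k O _ _ _ (unit1 A) _ edge_compatible). Qed.
End EdgeContraction.

(** * Homotopy identities and acyclicity of the twisted operad *)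

Section Homotopies.
Variables (k : fieldType) (O : dgOperad k).
Notation A := (free_operad O).
Notation B := (unital A).
Notation dA := (@fder k O _ _).
Notation dB := (@udd k (free_dg O) _ _).
Notation m := (free_m O).

Lemma strip0 n p : strip (0 : A n p) = 0.
Proof. exact: lin0 (@strip_lin _ _ _ _). Qed.
Lemma stripD n p (x y : A n p) : strip (x + y) = strip x + strip y.
Proof. exact: linD (@strip_lin _ _ _ _) _ _. Qed.
Lemma stripZ n p e (x : A n p) : strip (e *: x) = e *: strip x.
Proof. exact: linZ (@strip_lin _ _ _ _) _ _. Qed.
Lemma stripN n p (x : A n p) : strip (- x) = - strip x.
Proof. exact: linN (@strip_lin _ _ _ _) _. Qed.

Lemma dA0 n p : dA (0 : A n p) = 0. Proof. exact: lin0 (@fder_lin _ _ _ _). Qed.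
Lemma dAD n p (x y : A n p) : dA (x + y) = dA x + dA y.
Proof. exact: linD (@fder_lin _ _ _ _) _ _. Qed.
Lemma dAZ n p e (x : A n p) : dA (e *: x) = e *: dA x.
Proof. exact: linZ (@fder_lin _ _ _ _) _ _. Qed.
Lemma dB0 n p : dB (0 : B n p) = 0.
Proof. exact: lin0 (@udd_lin _ _ _ _). Qed.
Lemma dBD n p (x y : B n p) : dB (x + y) = dB x + dB y.
Proof. exact: linD (@udd_lin _ _ _ _) _ _. Qed.
Lemma dBZ n p e (x : B n p) : dB (e *: x) = e *: dB x.
Proof. exact: linZ (@udd_lin _ _ _ _) _ _. Qed.
Lemma dB_comp a b c p q r (ec : c.+1 = (a + b)%N) (er : r = p (+) q)
    (i : 'I_a) (x : B a p) (y : B b q) :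
  dB (comp ec er i x y) =
  comp ec (parNl er) i (dB x) y + (-1) ^+ p *: comp ec (parNr er) i x (dB y).
Proof. exact: (@udd_comp k (free_dg O)). Qed.
Lemma dA_comp a b c p q r (ec : c.+1 = (a + b)%N) (er : r = p (+) q)
    (i : 'I_a) (x : A a p) (y : A b q) :
  dA (comp ec er i x y) =
  comp ec (parNl er) i (dA x) y + (-1) ^+ p *: comp ec (parNr er) i x (dA y).
Proof. exact: fder_comp. Qed.

Definition mroot n p (X : B n p) : B n (~~ p) :=
  comp (erefl : n.+1 = (1 + n)%N) (erefl : ~~ p = true (+) p) ord0 (uincl m) X.

Lemma mroot_lin n p : linear (@mroot n p).
Proof. exact: comp_linr. Qed.

Lemma mroot_act n p (s : 'S_n) (X : B n p) : mroot (act s X) = act s (mroot X).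
Proof.
rewrite /mroot -{1}[uincl m]act1.
rewrite (@comp_act _ B _ _ _ _ _ _ _ _ _ 1%g s s) ?perm1 //.
split=> [l v e|j v]; last by rewrite ord1 eqxx.
by rewrite perm1 /= add0n; congr (val (s _)); apply: val_inj; exact: e.
Qed.

(* [strip] is a contracting homotopy onto the composites rooted in [m].       *)
Lemma strip_dd n p (x : A n p) :
  dB (strip x) + strip (dA x) = - mroot (strip x).
Proof.
move: n p x; apply: Tind.
- move=> n p x; rewrite fder_incl !strip_incl dB0.
  by rewrite (lin0 (@mroot_lin _ _)) addr0 oppr0.
- rewrite strip_m fder_m stripN /square strip_comp strip_m.
  have -> : dB (unit1 A) = 0 by exact: unit1_dd (free_dg O).
  rewrite add0r; congr (- _); rewrite /mroot unit1l.
  rewrite (@unit1r _ A 1 1 true true) //.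
- by move=> n p; rewrite dA0 !strip0 dB0 addr0 (lin0 (@mroot_lin _ _)) oppr0.
- move=> n p x y hx hy; rewrite dAD !stripD dBD addrACA hx hy.
  by rewrite (linD (@mroot_lin _ _)) opprD.
- by move=> n p e x hx; rewrite dAZ !stripZ dBZ -scalerDr hx (linZ (@mroot_lin
  _ _)) scalerN.
- move=> n p s x hx; rewrite fder_act !strip_act mroot_act -actN -hx actD.
  by rewrite -(@udd_act k (free_dg O)).
- move=> a b c p q r ec er i x y hx hy.
  rewrite dA_comp stripD stripZ !strip_comp dB_comp.
  rewrite (eq_irrelevance (parNl (parNr er)) (parNr (parNl er))) signrN scaleNr.
  (* The two terms with [dA y] cancel because [x] and [strip x] have opposite parities. *)
  rewrite -[dB (uincl y)]/(uincl (dA y)) addrACA addNr addr0 -compDl hx compNl.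
  by congr (- _); apply: (@comp_seq _ B).
Qed.

(* Scalar components do not contribute: they are multiples of the unit, which *)
(* commutes with [m].                                                         *)
Lemma twd_unital n p (X : B n p) :
  (dB X + delta (uincl m) (erefl : ~~ p = true (+) p) X).1 =
  dA X.1 + delta m (erefl : ~~ p = true (+) p) X.1.
Proof.
case: X => x al; rewrite /=; congr (_ + _).
have S (F : 'I_n -> B n (~~ p)) : (\sum_i F i).1 = \sum_i (F i).1.
  exact: (big_morph (fun X : B n (~~ p) => X.1)).
rewrite S /= scale0r addr0 /delta.
rewrite (eq_bigr (fun i : 'I_n =>
  comp (ar1 n) (parC erefl) i x m + al *: recast n (~~ p) m)); last first.
  by move=> i _; rewrite addr0.
rewrite big_split /= scalerDr opprD addrACA -[RHS]addr0; congr (_ + _).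
have [/andP[/eqP n1 /eqP p1]|ne] := boolP ((1%N == n) && (true == ~~ p)).
  by subst n; move: p1; case: (p) => // _; rewrite big_ord1 scale1r subrr.
by rewrite recast_ne // scaler0 big1 // scaler0 subr0.
Qed.

(** The untwisted part gives [- mroot (strip x)], cancelling left composition with [m] in the twist
    of [strip x]. The sums over the inputs cancel since [strip] commutes with grafting at inputs.
    Only the stripping of [m o x] survives, and it returns [x]. *)
Lemma strip_twd n p (x : A n p) :
  dB (strip x) + delta (uincl m) (erefl : ~~ ~~ p = true (+) ~~ p) (strip x) +
  strip (dA x + delta m (erefl : ~~ p = true (+) p) x) =
  recast n (~~ ~~ p) (uincl x).
Proof.
rewrite /delta stripD addrACA strip_dd stripD stripN stripZ.
rewrite (linS (@strip_lin _ _ _ _)) strip_comp strip_m.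
rewrite unit1l -/(mroot (strip x)).
have -> : \sum_(i < n) strip (comp (ar1 n) (parC (erefl : ~~ p = true (+) p)) i
  x m) =
    \sum_(i < n) comp (ar1 n) (parC (erefl : ~~ ~~ p = true (+) ~~ p)) i (strip
      x) (uincl m).
  by apply: eq_bigr => i _; rewrite strip_comp; apply: comp_irr.
rewrite signrN scaleNr opprK addrCA addrA.
by rewrite [X in X + _]addrAC subrr add0r addrC subrK.
Qed.
End Homotopies.

(** For a cycle, [strip_twd] reads [x = D (strip x)]; by [twd_unital] the scalar component of
    [strip x] may be dropped. *)
Theorem hat_acyclic (k : fieldType) (O : dgOperad k) : acyclic (hat O).
Proof.
move=> n p x; rewrite /is_cycle => hx.
have hx' : fder x + delta (free_m O) (erefl : ~~ p = true (+) p) x = 0 := hx.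
have := congr1 fst (strip_twd x); rewrite hx'.
rewrite strip0 addr0 twd_unital recast_uincl.
(* Fixing the parity makes [~~ ~~ p] compute to [p], as [recast_id] requires. *)
case: p x hx {hx'} => x hx; rewrite /= recast_id => <-.
  exact: (@Boundary k (hat O) n false (strip x).1).
exact: (@Boundary k (hat O) n true (strip x).1).
Qed.

(** * Algebra of the leaf projections *)

Section LeafProjectionTheory.
Variables (k : fieldType) (O : operad k).
Notation A := (free_operad O).

Lemma leafproj0 v n p : leafproj v (0 : A n p) = 0.
Proof. exact: lin0 (@leafproj_lin _ _ _ _ _). Qed.
Lemma leafprojD v n p (x y : A n p) :
  leafproj v (x + y) = leafproj v x + leafproj v y.
Proof. exact: linD (@leafproj_lin _ _ _ _ _) _ _. Qed.
Lemma leafprojZ v n p e (x : A n p) : leafproj v (e *: x) = e *: leafproj v x.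
Proof. exact: linZ (@leafproj_lin _ _ _ _ _) _ _. Qed.
Lemma leafprojN v n p (x : A n p) : leafproj v (- x) = - leafproj v x.
Proof. exact: linN (@leafproj_lin _ _ _ _ _) _. Qed.

(** For idempotence and commutation it matters only that one translation [w] of the leaf [v] serves
    all factors [x] and [y]. *)
Variant leafproj_comp_spec a b c p q r (ec : c.+1 = (a + b)%N)
    (er : r = p (+) q) (i : 'I_a) v : Prop :=
| LeafLeft w of forall (x : A a p) (y : A b q),
    leafproj v (comp ec er i x y) = comp ec er i (leafproj w x) y
| LeafRight w of forall (x : A a p) (y : A b q),
    leafproj v (comp ec er i x y) = comp ec er i x (leafproj w y).

Lemma leafproj_compP a b c p q r (ec : c.+1 = (a + b)%N) (er : r = p (+) q)
    (i : 'I_a) v : leafproj_comp_spec ec er i v.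
Proof.
have [h1|h1] := ltnP v i.
  by apply: (@LeafLeft _ _ _ _ _ _ _ _ _ _ v) => x y; rewrite leafproj_comp h1.
have [h2|h2] := ltnP v (i + b).
  by apply: (@LeafRight _ _ _ _ _ _ _ _ _ _ (v - i)) => x y;
    rewrite leafproj_comp ltnNge h1 h2.
apply: (@LeafLeft _ _ _ _ _ _ _ _ _ _ (v.+1 - b)) => x y.
by rewrite leafproj_comp ltnNge h1 ltnNge h2.
Qed.

Lemma leafprojK v n p (x : A n p) : leafproj v (leafproj v x) = leafproj v x.
Proof.
move: n p x v; apply: Tind.
- by move=> n p x v; rewrite leafproj_incl leafproj0.
- by case=> [|v]; rewrite !leafproj_m // leafproj0.
- by move=> n p v; rewrite !leafproj0.
- by move=> n p x y hx hy v; rewrite !leafprojD hx hy.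
- by move=> n p e x hx v; rewrite !leafprojZ hx.
- by move=> n p s x hx v; rewrite !leafproj_act hx.
- move=> a b c p q r ec er i x y hx hy v.
  by case: (leafproj_compP ec er i v) => w E; rewrite !E ?hx ?hy.
Qed.

Lemma leafprojC v w n p (x : A n p) :
  leafproj v (leafproj w x) = leafproj w (leafproj v x).
Proof.
move: n p x v w; apply: Tind.
- by move=> n p x v w; rewrite !leafproj_incl !leafproj0.
- by move=> [|v] [|w]; rewrite !leafproj_m ?leafproj0 // !leafproj_m.
- by move=> n p v w; rewrite !leafproj0.
- by move=> n p x y hx hy v w; rewrite !leafprojD hx hy.
- by move=> n p e x hx v w; rewrite !leafprojZ hx.
- by move=> n p s x hx v w; rewrite !leafproj_act hx.
- move=> a b c p q r ec er i x y hx hy v w.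
  case: (leafproj_compP ec er i v) => v' Ev;
    case: (leafproj_compP ec er i w) => w' Ew.
  + by rewrite Ew !Ev Ew hx.
  + by rewrite Ew !Ev Ew.
  + by rewrite Ew !Ev Ew.
  + by rewrite Ew !Ev Ew hy.
Qed.
End LeafProjectionTheory.

(** The differential preserves [O] and sends [m] to [- m^2], whose input is again the input of an
    [m]. *)
Lemma leafproj_dd (k : fieldType) (O : dgOperad k) v n p (x : free_operad O n
  p) :
  fder (leafproj v x) = leafproj v (fder x).
Proof.
move: n p x v; apply: Tind.
- by move=> n p x v; rewrite fder_incl !leafproj_incl dA0.
- case=> [|v]; rewrite fder_m leafprojN /square.
    by rewrite (@leafproj_comp_in _ _ _ _ _ _ _ _ _ _ _ _ _ 0 ord0) //
      !leafproj_m fder_m.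
  (* An index past the only input is passed on to the left factor, where it gives zero. *)
  rewrite (@leafproj_comp_out _ _ _ _ _ _ _ _ _ _ _ _ _ v.+1 v.+1) ?addn1 //.
  by rewrite !leafproj_m dA0 comp0l oppr0.
- by move=> n p v; rewrite dA0 !leafproj0 dA0.
- by move=> n p x y hx hy v; rewrite dAD !leafprojD dAD hx hy.
- by move=> n p e x hx v; rewrite dAZ !leafprojZ dAZ hx.
- by move=> n p s x hx v; rewrite fder_act !leafproj_act fder_act hx.
- move=> a b c p q r ec er i x y hx hy v.
  rewrite dA_comp leafprojD leafprojZ !leafproj_comp.
  by case: (v < i)%N; [|case: (v < i + b)%N]; rewrite dA_comp ?hx ?hy.
Qed.

(** * Induction along right combs *)

Section RightCombs.
Variables (k : fieldType) (O : operad k).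
Notation A := (free_operad O).

Definition block1 b i (t : 'S_b) (v : nat) : nat :=
  if (v < i)%N then v else if (v < i + b)%N then (i + natperm t (v - i))%N else
    v.

Lemma natperm_lt n (t : 'S_n) v : (v < n)%N -> (natperm t v < n)%N.
Proof. by move=> h; rewrite (@natperm_ord _ _ (Ordinal h)). Qed.

Lemma natperm_inj n (t : 'S_n) : injective (natperm t).
Proof.
move=> v w; have [h1|h1] := leqP n v; have [h2|h2] := leqP n w.
- by rewrite !natperm_ge.
- by rewrite natperm_ge // => e; have := natperm_lt t h2; lia.
- by rewrite [natperm _ w]natperm_ge // => e; have := natperm_lt t h1; lia.
rewrite (@natperm_ord _ _ (Ordinal h1)) // (@natperm_ord _ _ (Ordinal h2)) //.
by move=> /val_inj/perm_inj/(congr1 val).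
Qed.

(** This allows a permutation of the right factor to be pulled out of a composite by [comp_act]. *)
Lemma block1_perm a b c (ec : c.+1 = (a + b)%N) (i : 'I_a) (t : 'S_b) :
  exists u : 'S_c, block_perm i 1%g t u.
Proof.
have ia := ltn_ord i.
have lt (v : 'I_c) : (block1 i t v < c)%N.
  rewrite /block1; have vc := ltn_ord v; case: ifP => // h1; case: ifP => // h2.
  have : (v - i < b)%N by lia.
  by move/(natperm_lt t); lia.
have inj : injective (fun v => Ordinal (lt v)).
  move=> v w /(congr1 val) /= h; apply: val_inj; move: h; rewrite /= /block1.
  have L (z : 'I_c) : (i <= z < i + b)%N -> (natperm t (z - i) < b)%N.
    by move=> h; apply: natperm_lt; lia.
  have := L v; have := L w.
  repeat case: ifP => ?; try lia.
  move=> _ _ /addnI/natperm_inj; lia.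
exists (perm inj); split=> [l v e|j v ne e]; rewrite permE /= /block1.
  rewrite e ltnNge leq_addr /= ltn_add2l ltn_ord perm1 addKn.
  by rewrite (@natperm_ord _ _ l).
by rewrite !perm1; have := ltn_ord j; move: e ne; rewrite /outer -val_eqE /=;
  repeat case: ifP => ?; lia.
Qed.

(* Every element is a combination of iterated compositions in which the right *)
(* factor is a generator.                                                     *)
Lemma right_comb_ind (T : forall n p, A n p -> Prop) :
  (forall n p x, T n p (free_incl O n p x)) -> T _ _ (free_m O) ->
  (forall n p, T n p 0) ->
  (forall n p x y, T n p x -> T n p y -> T n p (x + y)) ->
  (forall n p c x, T n p x -> T n p (c *: x)) ->
  (forall n p s x, T n p x -> T n p (act s x)) ->
  (forall a b c p q r (ec : c.+1 = (a + b)%N) (er : r = p (+) q) i x y,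
     T a p x -> T c r (comp ec er i x (free_incl O b q y))) ->
  (forall a c p r (ec : c.+1 = (a + 1)%N) (er : r = p (+) true) i x,
     T a p x -> T c r (comp ec er i x (free_m O))) ->
  forall n p x, T n p x.
Proof.
move=> hg hm h0 hD hZ hA hCg hCm.
(* The induction also needs that grafting [y] onto an element of [T] stays in [T]. *)
suff S n p (y : A n p) : T n p y /\ forall a c q r (ec : c.+1 = (a + n)%N)
    (er : r = q (+) p) i x, T a q x -> T c r (comp ec er i x y).
  by move=> n p x; case: (S n p x).
move: n p y; apply: Tind.
- by move=> n p y; split=> // *; exact: hCg.
- by split=> // *; exact: hCm.
- by move=> n p; split=> // *; rewrite comp0r.
- by move=> n p x y [hx hx'] [hy hy']; split=> *; [exact: hD|rewrite compDr;
  apply: hD; auto].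
- by move=> n p e x [hx hx']; split=> *; [exact: hZ|rewrite compZr; apply: hZ;
  auto].
- move=> n p s x [hx hx']; split=> [|a c q r ec er i y hy]; first exact: hA.
  have [u hu] := block1_perm ec i s.
  rewrite -[y]act1 (comp_act _ _ _ _ hu); apply: hA; exact: hx'.
- move=> a b c p q r ec er i x y [hx hx'] [hy hy']; split; first exact: hy'.
  move=> a' c' q' r' ec' er' i' z hz.
  have ia := ltn_ord i; have ia' := ltn_ord i'.
  have e1 : (a' + a).-1.+1 = (a' + a)%N by lia.
  have e2 : c'.+1 = ((a' + a).-1 + b)%N by lia.
  have lt : (i' + i < (a' + a).-1)%N by lia.
  have f2 : r' = (q' (+) p) (+) q by rewrite er' er addbA.
  (* Reassociating to [(z o x) o y] grafts the two factors one after the other. *)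
  rewrite -(comp_seq e1 erefl e2 f2 ec er ec' er' (l := Ordinal lt)) //.
  by apply: hy'; apply: hx'.
Qed.
End RightCombs.

(** * The edge count as an anticommutator *)

Section EdgeCount.
Variables (k : fieldType) (O : dgOperad k).
Notation A := (free_operad O).
Notation B := (unital A).
Notation dA := (@fder k O _ _).
Notation dB := (@udd k (free_dg O) _ _).
Notation m := (free_m O).

Lemma contractD n p (x y : A n p) : contract (x + y) = contract x + contract y.
Proof. exact: linD (@contract_lin _ _ _ _) _ _. Qed.
Lemma contractZ n p e (x : A n p) : contract (e *: x) = e *: contract x.
Proof. exact: linZ (@contract_lin _ _ _ _) _ _. Qed.
Lemma contractN n p (x : A n p) : contract (- x) = - contract x.
Proof. exact: linN (@contract_lin _ _ _ _) _. Qed.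

(** This is [dH + Hd], the negative of the edge count, before its parity [~~ ~~ p] is brought back
    to [p]. *)
Definition edges n p (x : A n p) : B n (~~ ~~ p) :=
  dB (contract x) + contract (dA x).

Lemma edges_lin n p : linear (@edges n p).
Proof.
move=> e x y; rewrite /edges !(contract_lin, fder_lin) (@udd_lin k (free_dg O)).
by rewrite scalerDr addrACA.
Qed.

Lemma edges_act n p (s : 'S_n) (x : A n p) : edges (act s x) = act s (edges x).
Proof.
rewrite /edges fder_act !contract_act actD; congr (_ + _).
exact: (@udd_act k (free_dg O)).
Qed.

Lemma edges_incl n p (x : O n p) : edges (free_incl O n p x) = 0.
Proof. by rewrite /edges fder_incl !contract_incl dB0 addr0. Qed.

(** The two factors of [m^2] lie on a single edge, so contracting [m^2] gives [m] once. *)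
Lemma edges_m : edges m = - uincl m.
Proof.
rewrite /edges contract_m fder_m contractN /square contract_comp.
have -> : dB (unit1 A) = 0 by exact: unit1_dd (free_dg O).
rewrite leafproj_m contract_m strip_m addrK add0r unit1l.
by rewrite [recast _ _ _](@recast_id _ B 1 true).
Qed.

(** An anticommutator of odd derivations is a derivation; the correction in [contract] adds the last
    term, by [leafproj_dd] and [strip_dd]. As [mroot (strip y)] is the part of [y] rooted in [m],
    this term prevents the glued edge from being counted twice. *)
Lemma edges_comp a b c p q r (ec : c.+1 = (a + b)%N) (er : r = p (+) q)
    (i : 'I_a) (x : A a p) (y : A b q) :
  edges (comp ec er i x y) =
  comp ec (parNl (parNl er)) i (edges x) (uincl y) +
  comp ec (parNr (parNr er)) i (uincl x) (edges y) +
  comp ec (parNr (parNr er)) i (uincl (leafproj i x)) (mroot (strip y)).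
Proof.
have -> : mroot (strip y) = - (dB (strip y) + strip (dA y)) by rewrite strip_dd
  opprK.
rewrite /edges dA_comp contractD contractZ !contract_comp.
rewrite dBD dBD -[- (_ *: _)]scaleNr !dBZ !dB_comp.
rewrite (eq_irrelevance (parNl (parNr er)) (parNr (parNl er))) !signrN.
rewrite -leafproj_dd -![dB (uincl _)]/(uincl _).
rewrite [in RHS]compDl compNr !compDr.
(* Here [s] is the sign of [x]; the mixed terms [b1], [c1], [f1] cancel in pairs. *)
have L (U : lmodType k) (s : k) (a1 a2 b1 c1 e1 e2 f1 g1 g2 : U) : s * s = 1 ->
  a1 + - s *: b1 + s *: (c1 + s *: e1) + - s *: (f1 + s *: g1) +
  (a2 + - s *: c1 - - s *: f1 + s *: (b1 + s *: e2 - s *: g2)) =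
  a1 + a2 + (e1 + e2) - (g1 + g2).
  move=> ss; rewrite !(scalerDr, scalerN, scalerA, scaleNr, mulNr,
    opprK) ss !scale1r.
  rewrite [LHS](AC ((2*2*2)*(3*3)) ((1*7)*(4*11)*(6*12)*(2*10)*(3*8)*(5*9))) /=.
  by rewrite !addNr subrr !addr0 opprD.
by apply: L; rewrite -signr_addb addbb.
Qed.

(** Thanks to this, the operad component of a composite with [edges x] depends only on that of
    [edges x]. *)
Lemma edges_scalar n p (x : A n p) : (edges x).2 = 0.
Proof.
move: n p x; apply: Tind.
- by move=> n p x; rewrite edges_incl.
- by rewrite edges_m /= oppr0.
- by move=> n p; rewrite (lin0 (@edges_lin _ _)).
- by move=> n p x y hx hy; rewrite (linD (@edges_lin _ _)) -[LHS]/((edges x).2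
  + (edges y).2) hx hy addr0.
- by move=> n p e x hx; rewrite (linZ (@edges_lin _ _)) -[LHS]/(e *: (edges
  x).2) hx scaler0.
- by move=> n p s x hx; rewrite edges_act -[LHS]/((edges x).2).
- move=> a b c p q r ec er i x y hx hy.
  by rewrite edges_comp /= !(mul0r, mulr0) !if_same !addr0.
Qed.

(* Counts the edges which carry an [m].                                       *)
Definition edgecount n p (x : A n p) : A n p :=
  locked (- recast n p (edges x).1).

Lemma edgecount_lin n p : linear (@edgecount n p).
Proof.
move=> e x y; rewrite /edgecount -!lock edges_lin /= recastD recastZ opprD.
by rewrite scalerN.
Qed.
Lemma edgecount0 n p : edgecount (0 : A n p) = 0.
Proof. exact: lin0 (@edgecount_lin _ _). Qed.
Lemma edgecountD n p (x y : A n p) : edgecount (x + y) = edgecount x +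
  edgecount y.
Proof. exact: linD (@edgecount_lin _ _) _ _. Qed.
Lemma edgecountZ n p e (x : A n p) : edgecount (e *: x) = e *: edgecount x.
Proof. exact: linZ (@edgecount_lin _ _) _ _. Qed.
Lemma edgecountB n p (x y : A n p) : edgecount (x - y) = edgecount x -
  edgecount y.
Proof. by rewrite edgecountD (linN (@edgecount_lin _ _)). Qed.

Lemma edgecount_act n p (s : 'S_n) (x : A n p) :
  edgecount (act s x) = act s (edgecount x).
Proof.
rewrite /edgecount -!lock edges_act actN; congr (- _).
by apply: recast_act => v v' /val_inj ->.
Qed.

Lemma edgecount_incl n p (x : O n p) : edgecount (free_incl O n p x) = 0.
Proof. by rewrite /edgecount -!lock edges_incl recast0 oppr0. Qed.

Lemma edgecount_m : edgecount m = m.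
Proof. by rewrite /edgecount -!lock edges_m recastN recast_id opprK. Qed.

Lemma comp_uincl1 a b c p q r (ec : c.+1 = (a + b)%N) (er : r = p (+) q)
    (i : 'I_a) (X : B a p) (y : A b q) : X.2 = 0 ->
  (comp ec er i X (uincl y)).1 = comp ec er i X.1 y.
Proof. by move=> /= ->; rewrite !scale0r !addr0. Qed.

Lemma edges_comp1 a b c p q r (ec : c.+1 = (a + b)%N) (er : r = p (+) q)
    (i : 'I_a) (x : A a p) (y : A b q) :
  recast c r (comp ec (parNl (parNl er)) i (edges x) (uincl y)).1 =
  - comp ec er i (edgecount x) y.
Proof.
rewrite /edgecount -!lock compNl opprK.
rewrite (recast_compl (i := i) ec (parNl (parNl er)) ec er) //;
  congr (recast _ _ _).
by rewrite comp_uincl1 // edges_scalar.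
Qed.

(** An element of [O] has no marked edge and no [m] at its root. *)
Lemma edgecount_comp_incl a b c p q r (ec : c.+1 = (a + b)%N) (er : r = p (+) q)
    (i : 'I_a) (x : A a p) (y : O b q) :
  edgecount (comp ec er i x (free_incl O _ _ y)) =
  comp ec er i (edgecount x) (free_incl O _ _ y).
Proof.
rewrite {1}/edgecount -lock edges_comp edges_incl strip_incl (lin0 (@mroot_lin
  _ _ _ _)).
by rewrite !comp0r !addr0 edges_comp1 opprK.
Qed.

(** Grafting [m] marks a new edge, except on the part of [x] whose leaf [i] already carries an
    [m]. *)
Lemma edgecount_comp_m a c p r (ec : c.+1 = (a + 1)%N) (er : r = p (+) true)
    (i : 'I_a) (x : A a p) :
  edgecount (comp ec er i x m) =
  comp ec er i (edgecount x) m + comp ec er i (x - leafproj i x) m.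
Proof.
rewrite {1}/edgecount -lock edges_comp edges_m strip_m.
have -> : mroot (unit1 A) = uincl m.
  by rewrite /mroot (@unit1r _ A 1 1 true true) //; exact: recast_id.
have R (z : A a p) : recast c r (comp ec (parNr (parNr er)) i (uincl z) (uincl
  m)).1 =
    comp ec er i z m.
  by rewrite -uincl_comp -(recast_compl (i := i) (i' := i) ec (parNr (parNr
    er)) ec er) // recast_id.
rewrite compNr -[X in recast _ _ X]/(
  (comp ec (parNl (parNl er)) i (edges x) (uincl m)).1 -
  (comp ec (parNr (parNr er)) i (uincl x) (uincl m)).1 +
  (comp ec (parNr (parNr er)) i (uincl (leafproj i x)) (uincl m)).1).
have RB (X Y Z : A c (~~ ~~ r)) :
    recast c r (X - Y + Z) = recast c r X - recast c r Y + recast c r Z.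
  by rewrite !recastD recastN.
by rewrite RB edges_comp1 !R !opprD !opprK compDl compNl addrA.
Qed.
End EdgeCount.

(** * Eigenvalues of the edge count *)

Section Spectrum.
Variables (k : fieldType) (O : dgOperad k).
Notation A := (free_operad O).
Notation m := (free_m O).
Notation incl := (free_incl O).

(** Both operators are diagonal on trees. Without normal forms, right combs serve instead, since the
    count is explicit when a generator is grafted. *)
Lemma leafproj_edgecount v n p (x : A n p) :
  leafproj v (edgecount x) = edgecount (leafproj v x).
Proof.
move: n p x v; apply: right_comb_ind.
- by move=> n p x v; rewrite edgecount_incl leafproj_incl leafproj0 edgecount0.
- case=> [|v]; first by rewrite edgecount_m leafproj_m edgecount_m.
  by rewrite edgecount_m leafproj_m edgecount0.
- by move=> n p v; rewrite edgecount0 !leafproj0 edgecount0.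
- by move=> n p x y hx hy v; rewrite edgecountD !leafprojD edgecountD hx hy.
- by move=> n p e x hx v; rewrite edgecountZ leafprojZ hx [in RHS]leafprojZ
  edgecountZ.
- by move=> n p s x hx v; rewrite edgecount_act !leafproj_act edgecount_act hx.
- move=> a b c p q r ec er i x y hx v; rewrite edgecount_comp_incl.
  case: (leafproj_compP O ec er i v) => w E; rewrite !E.
    by rewrite edgecount_comp_incl hx.
  by rewrite leafproj_incl !comp0r edgecount0.
- move=> a c p r ec er i x hx v; rewrite edgecount_comp_m leafprojD.
  case: (leafproj_compP O ec er i v) => w E; rewrite !E.
    by rewrite edgecount_comp_m hx leafprojD leafprojN leafprojC.
  case: w E => [|w] E; rewrite leafproj_m; first by rewrite edgecount_comp_m.
  by rewrite !comp0r addr0 edgecount0.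
Qed.

(* [(N - 1) ... (N - M) x] for the edge count [N].                            *)
Fixpoint killpos M n p (x : A n p) : A n p :=
  if M is M'.+1 then edgecount (killpos M' x) - M%:R *: killpos M' x else x.

Lemma killposS M n p (x : A n p) :
  killpos M.+1 x = edgecount (killpos M x) - M.+1%:R *: killpos M x.
Proof. by []. Qed.

Lemma killpos_lin M n p : linear (@killpos M n p).
Proof.
elim: M => [|M IH] e x y //=; rewrite !IH edgecount_lin !scalerDr opprD addrACA.
by rewrite scalerN !scalerA mulrC.
Qed.
Lemma killpos0 M n p : killpos M (0 : A n p) = 0.
Proof. exact: lin0 (@killpos_lin M n p). Qed.

Lemma killpos_act M n p (s : 'S_n) (x : A n p) :
  killpos M (act s x) = act s (killpos M x).
Proof. by elim: M => // M IH; rewrite !killposS IH edgecount_act actD actN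
  actZ. Qed.

Lemma killpos_comp_incl M a b c p q r (ec : c.+1 = (a + b)%N)
    (er : r = p (+) q) (i : 'I_a) (x : A a p) (y : O b q) :
  killpos M (comp ec er i x (incl _ _ y)) = comp ec er i (killpos M x) (incl _
    _ y).
Proof.
elim: M => [//|M IH]; rewrite killposS IH edgecount_comp_incl.
by rewrite compDl compNl compZl.
Qed.

Lemma killpos_leafproj M v n p (x : A n p) :
  killpos M (leafproj v x) = leafproj v (killpos M x).
Proof.
elim: M => // M IH; rewrite !killposS IH -leafproj_edgecount -leafprojZ.
by rewrite leafprojD leafprojN.
Qed.

Lemma killpos_edgecount M n p (x : A n p) :
  killpos M (edgecount x) = edgecount (killpos M x).
Proof. by elim: M => // M IH; rewrite !killposS IH edgecountB edgecountZ. Qed.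

(* On [y o_i m], the count of [y] is correct if the input [i] of [y] already  *)
(* carries an [m], and is one too small if it does not.                       *)
Lemma killpos_comp_m M a c p r (ec : c.+1 = (a + 1)%N) (er : r = p (+) true)
    (i : 'I_a) (y : A a p) : leafproj i y = y ->
  killpos M (comp ec er i y m) = comp ec er i (killpos M y) m.
Proof.
move=> hy; elim: M => [//|M IH]; rewrite killposS IH edgecount_comp_m.
by rewrite -killpos_leafproj hy subrr comp0l addr0 killposS compDl compNl
  compZl.
Qed.

(** The count on the composite is [N + 1], with [N] the count on [z], so [(N - 1) ... (N - M - 1)]
    becomes [N (N - 1) ... (N - M)]. *)
Lemma killposS_comp_m M a c p r (ec : c.+1 = (a + 1)%N) (er : r = p (+) true)
    (i : 'I_a) (z : A a p) : leafproj i z = 0 ->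
  killpos M.+1 (comp ec er i z m) = comp ec er i (killpos M (edgecount z)) m.
Proof.
move=> hz; elim: M => [|M IH].
  by rewrite killposS edgecount_comp_m hz subr0 scale1r addrK.
rewrite killposS IH edgecount_comp_m.
rewrite -killpos_leafproj leafproj_edgecount hz edgecount0 killpos0 subr0.
rewrite killposS compDl compNl compZl -addrA; congr (_ + _).
by rewrite -[M.+2]add1n natrD scalerDl scale1r opprD addNKr.
Qed.

Definition in_incl n p (x : A n p) : Prop := exists y : O n p, x = incl n p y.

(** The count vanishes on [O], so every further factor acts there as a scalar. *)
Lemma killpos_le M M' n p (x : A n p) : (M <= M')%N ->
  in_incl (killpos M x) -> in_incl (killpos M' x).
Proof.
move=> /subnK <-; elim: (M' - M)%N => [//|d IH] /IH [y e].
exists (- (d + M).+1%:R *: y); rewrite addSn killposS e edgecount_incl sub0r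
  scaleNr.
by rewrite (linN (@fmor_lin _ _ _ _ _ _)) (linZ (@fmor_lin _ _ _ _ _ _)).
Qed.

(** Along a right comb, grafting an element of [O] keeps [M], and grafting [m] raises it by one. *)
Lemma killpos_ex n p (x : A n p) : exists M, in_incl (killpos M x).
Proof.
move: n p x; apply: right_comb_ind.
- by move=> n p x; exists 0; exists x.
- by exists 1; exists 0; rewrite killposS edgecount_m scale1r subrr (lin0
  (@fmor_lin _ _ _ _ _ _)).
- by move=> n p; exists 0; exists 0; rewrite (lin0 (@fmor_lin _ _ _ _ _ _)).
- move=> n p x y [M hx] [M' hy]; exists (maxn M M').
  have [x' ex] := killpos_le (leq_maxl M M') hx.
  have [y' ey] := killpos_le (leq_maxr M M') hy.
  exists (x' + y'); rewrite (linD (@killpos_lin _ _ _)) ex ey.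
  by rewrite (linD (@fmor_lin _ _ _ _ _ _)).
- move=> n p e x [M [x' ex]]; exists M; exists (e *: x').
  by rewrite (linZ (@killpos_lin _ _ _)) ex (linZ (@fmor_lin _ _ _ _ _ _)).
- move=> n p s x [M [x' ex]]; exists M; exists (act s x').
  by rewrite killpos_act ex fmor_act.
- move=> a b c p q r ec er i x y [M [x' ex]]; exists M;
  exists (comp ec er i x' y).
  by rewrite killpos_comp_incl ex fmor_comp.
- move=> a c p r ec er i x [M [x' ex]]; exists M.+1; exists 0.
  rewrite (lin0 (@fmor_lin _ _ _ _ _ _)).
  (* The composite with [m] is killed altogether. Where the leaf [i] carries no [m], the extra
     factor [N] annihilates [killpos M x], which lies in [O]; on the other part, the leaf projection
     annihilates it. *)
  rewrite -[x](subrK (leafproj i x)) compDl (linD (@killpos_lin _ _ _)).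
  rewrite killposS_comp_m; last by rewrite leafprojD leafprojN leafprojK subrr.
  rewrite killpos_comp_m ?leafprojK //.
  rewrite killpos_edgecount (linD (@killpos_lin _ _ _)) (linN (@killpos_lin _ _
    _)).
  rewrite killposS !killpos_leafproj ex leafproj_incl subr0 edgecount_incl.
  by rewrite edgecount0 scaler0 subr0 !comp0l addr0.
Qed.
End Spectrum.

(** * Boundaries and the quasi-isomorphism *)

(** The equation form keeps the parity [p] a variable, unlike inversion of the inductive
    predicate. *)
Lemma boundaryP (k : fieldType) (P : dgOperad k) n p (x : P n p) :
  is_boundary x <-> exists z : P n (~~ p), x = recast n p (dd z).
Proof.
split=> [[q y]|[z ->]].
  exists (recast n (~~ ~~ q) y).
  by rewrite recast_dd recast_recast eqxx !negbK eqxx recast_id.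
by case: p x z => x z; rewrite recast_id;
  [exact: (@Boundary _ _ _ false z)|exact: (@Boundary _ _ _ true z)].
Qed.

Lemma boundary_linear (k : fieldType) (P : dgOperad k) n p e (x y : P n p) :
  is_boundary x -> is_boundary y -> is_boundary (e *: x + y).
Proof.
move=> /boundaryP[z ->] /boundaryP[t ->]; apply/boundaryP; exists (e *: z + t).
by rewrite dd_lin recast_lin.
Qed.

Lemma boundary0 (k : fieldType) (P : dgOperad k) n p : is_boundary (0 : P n p).
Proof.
by apply/boundaryP; exists 0; rewrite (lin0 (@dd_lin _ _ _ _)) recast0.
Qed.

Lemma boundaryZ (k : fieldType) (P : dgOperad k) n p e (x : P n p) :
  is_boundary x -> is_boundary (e *: x).
Proof.
by move=> hx; have := boundary_linear e hx (boundary0 P n p); rewrite addr0.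
Qed.

Lemma dg_mor_boundary (k : fieldType) (P Q : dgOperad k) (f : dg_mor P Q) n p
    (x : P n p) : is_boundary x -> is_boundary (f n p x).
Proof. by case=> q y; rewrite dgmor_dd; exact: Boundary. Qed.

Section QuasiIso.
Variables (k : fieldType) (O : dgOperad k).
Notation A := (free_operad O).
Notation incl := (free_incl O).

(** Sending [m] to 0 turns [d(m) = - m^2] into [0 = 0]. The resulting dg retraction onto [O] makes
    the inclusion injective on homology. *)
Lemma lift0_dd n p (x : A n p) :
  free_lift (id_mor O) 0 _ _ (fder x) = dd (free_lift (id_mor O) 0 _ _ x).
Proof.
have flin n1 p1 := @fmor_lin _ _ _ (free_lift (id_mor O) (0 : O 1 true)) n1 p1.
move: n p x; apply: Tind.
- by move=> n p x; rewrite fder_incl !free_lift_incl.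
- rewrite fder_m (linN (flin _ _)) /square fmor_comp !free_lift_m comp0l oppr0.
  by rewrite (lin0 (@dd_lin _ _ _ _)).
- by move=> n p; rewrite dA0 !(lin0 (flin _ _)) (lin0 (@dd_lin _ _ _ _)).
- by move=> n p x y hx hy; rewrite dAD !(linD (flin _ _)) (linD (@dd_lin _ _ _
  _)) hx hy.
- by move=> n p e x hx; rewrite dAZ !(linZ (flin _ _)) (linZ (@dd_lin _ _ _ _))
  hx.
- by move=> n p s x hx; rewrite fder_act !fmor_act dd_act hx.
- move=> a b c p q r ec er i x y hx hy.
  rewrite dA_comp (linD (flin _ _)) (linZ (flin _ _)) !fmor_comp hx hy.
  by rewrite (dd_comp ec er (parNl er) (parNr er)).
Qed.

Definition free_dg_retract : dg_mor (free_dg O) O :=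
  @DGMor k (free_dg O) O (free_lift (id_mor O) 0) lift0_dd.

(** On a cycle [dH + Hd] reduces to [dH], and the differential ignores the scalar component of
    [contract y]. *)
Lemma edgecount_boundary n p (y : A n p) :
  is_cycle (y : free_dg O n p) -> is_boundary (edgecount y : free_dg O n p).
Proof.
move=> hy; apply/boundaryP; exists (- (contract y).1).
rewrite /edgecount -lock /edges; have -> : fder y = 0 by exact: hy.
rewrite (lin0 (@contract_lin _ _ _ _)) addr0 -recastN.
by rewrite (linN (@dd_lin _ _ _ _)).
Qed.

(** Modulo boundaries, [N] is zero on cycles, so each factor [N - j] acts as the scalar [- j]. *)
Lemma killpos_boundary M n p (y : A n p) : is_cycle (y : free_dg O n p) ->
  is_boundary (killpos M y - (\prod_(j < M) - j.+1%:R) *: y : free_dg O n p).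
Proof.
move=> hy; elim: M => [|M IH].
  rewrite big_ord0 scale1r subrr; exact: boundary0.
set c := \prod_(j < M) _ in IH.
have hb : is_boundary (edgecount (killpos M y) : free_dg O n p).
  (* By induction [killpos M y] is a multiple of [y] up to a boundary, hence a cycle. *)
  apply: edgecount_boundary; case/boundaryP: IH => z e.
  have -> : killpos M y = c *: y + recast n p (dd (z : free_dg O n (~~ p))).
    by rewrite -e addrC subrK.
  rewrite /is_cycle (linD (@dd_lin _ _ _ _)) (linZ (@dd_lin _ _ _ _)) hy
    scaler0.
  by rewrite add0r recast_dd dd_dd recast0.
have := boundary_linear (- M.+1%:R) IH hb.
rewrite killposS big_ord_recr /= -/c scalerBr addrC scalerA scaleNr addrA.
by rewrite [c * _]mulrC.
Qed.

Lemma free_dg_incl_quasi_iso : [pchar k] =i pred0 -> quasi_iso (free_dg_incl O).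
Proof.
move=> hk; split=> [n p x hx /(dg_mor_boundary free_dg_retract)|n p y hy].
  by rewrite -[x in _ -> is_boundary x](free_lift_incl (id_mor O) 0).
have [M [x ex]] := killpos_ex y; have := killpos_boundary M hy; rewrite ex.
set c := \prod_(j < M) _ => hb.
(* Up to sign [c] is [M!], invertible in characteristic 0. *)
have c0 : c != 0.
  by apply/prodf_neq0 => j _; rewrite oppr_eq0; have /pcharf0P -> := hk.
have hb' := boundaryZ (- c^-1) hb.
have e : - c^-1 *: (incl _ _ x - c *: y) = y - incl _ _ (c^-1 *: x).
  rewrite scalerBr !scaleNr opprK scalerA mulVf // scale1r addrC.
  by rewrite (linZ (@fmor_lin _ _ _ _ _ _)).
exists (c^-1 *: x); split; last by move: hb'; rewrite e.
(* The image of [c^-1 *: x] differs from the cycle [y] by a boundary, and the inclusion is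
   injective; so [c^-1 *: x] is a cycle. *)
apply: (@free_incl_inj _ O); rewrite -fder_incl (lin0 (@fmor_lin _ _ _ _ _ _)).
have -> : incl _ _ (c^-1 *: x) = y - (- c^-1 *: (incl _ _ x - c *: y)).
  by rewrite e opprB addrC subrK.
rewrite (linD (@fder_lin _ _ _ _)) (linN (@fder_lin _ _ _ _)) [fder y]hy sub0r.
case/boundaryP: hb' => z ->; rewrite -[fder _]/(dd (_ : free_dg O _ _)).
by rewrite recast_dd dd_dd recast0 oppr0.
Qed.
End QuasiIso.

Theorem theorem5p7 (k : fieldType) (hk : [pchar k] =i pred0) (O : dgOperad k) :
  quasi_iso (free_dg_incl O) /\ acyclic (hat O).
Proof. by split; [exact: free_dg_incl_quasi_iso|exact: hat_acyclic]. Qed.
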